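(* Consider the unforced system $\dot x(t)=\sum_{i=0}^r A_i(\theta(t))\,x(t-h_i)$ described in the context. Suppose there exist real symmetric matrices $P=P^T>0$ and $S_i=S_i^T>0$ ($i=1,\dots,r$), all of size $n\times n$, with the following property: for every $\theta\in\Theta$ there exist complex matrices $G_i=G_{\Delta i}(\Delta(\theta))\in\mathbb C^{n\times d_i}$ and $H_i=H_{\Delta i}(\Delta(\theta))\in\mathbb C^{d_i\times d_i}$ ($i=0,\dots,r$) such that the Hermitian matrix $Q(\Delta(\theta))$ of size $n(r+1)+d$ is negative definite. Here, writing $\Delta_i=\Delta_i(\theta)$, $Q$ is partitioned into row/column blocks of sizes $n$, $rn$, $d$, namely $Q=\begin{pmatrix}Q_{11}&Q_{12}&Q_{13}\\ Q_{12}^*&Q_{22}&Q_{23}\\ Q_{13}^*&Q_{23}^*&Q_{33}\end{pmatrix}$ with $Q_{11}=A_{00}^TP+PA_{00}+\sum_{i=1}^r S_i+G_0C_{p0}+C_{p0}^TG_0^*$, $Q_{12}=[PA_{01},\,PA_{02},\dots,PA_{0r}]$, $Q_{13}=[\,PB_{q0}\Delta_0+G_0D_{pq0}\Delta_0-G_0+C_{p0}^TH_0^*,\ PB_{q1}\Delta_1,\dots,PB_{qr}\Delta_r\,]$, $Q_{22}=\mathrm{BlockDiag}\big(G_iC_{pi}+C_{pi}^TG_i^*-S_i\big)_{i=1,\dots,r}$, $Q_{23}=\big[\,0_{rn\times d_0},\ \mathrm{BlockDiag}\big(G_iD_{pqi}\Delta_i-G_i+C_{pi}^TH_i^*\big)_{i=1,\dots,r}\,\big]$,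 $Q_{33}=\mathrm{BlockDiag}\big(H_iD_{pqi}\Delta_i+(D_{pqi}\Delta_i)^TH_i^*-H_i-H_i^*\big)_{i=0,\dots,r}$. Then the unforced system is globally asymptotically stable independent of the delays.
   Context: Fix integers $n,m,r\ge1$ and a polytope $\Theta\subset\mathbb R^m$ containing the origin. For $i=0,\dots,r$ let $s_{1i},\dots,s_{mi}\ge0$ be integers, $d_i=\sum_{k=1}^m s_{ki}$, $d=\sum_{i=0}^r d_i$, and $\Delta_i(\theta)=\mathrm{diag}(\theta_1I_{s_{1i}},\dots,\theta_mI_{s_{mi}})\in\mathbb R^{d_i\times d_i}$ for $\theta=(\theta_1,\dots,\theta_m)\in\Theta$. Let $A_{0i}\in\mathbb R^{n\times n}$, $B_{qi}\in\mathbb R^{n\times d_i}$, $C_{pi}\in\mathbb R^{d_i\times n}$, $D_{pqi}\in\mathbb R^{d_i\times d_i}$ be real matrices with the well-posedness condition $\det(I_{d_i}-D_{pqi}\Delta_i(\theta))\neq0$ for all $\theta\in\Theta$, and set $A_i(\theta)=A_{0i}+B_{qi}\Delta_i(\theta)(I_{d_i}-D_{pqi}\Delta_i(\theta))^{-1}C_{pi}$. The unforced system is $\dot x(t)=\sum_{i=0}^rA_i(\theta(t))x(t-h_i)$, $x(t)\in\mathbb R^n$, with $h_0=0$, constant delays $h_1,\dots,h_r\ge0$, a (possibly time-varying) parameter trajectory $\theta:[0,\infty)\to\Theta$ for which solutions exist, and absolutely continuous initial function $x(t)=\varphi(t)$ on $[-h,0]$, $h=\max_i h_i$. The system is globally asymptotically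 stable if for every admissible trajectory $\theta(\cdot)$ with values in $\Theta$ and every initial function, $\|x(t)\|$ is uniformly bounded and $x(t)\to0$ as $t\to\infty$; ''independent of the delays'' means this holds for all $h_1,\dots,h_r\ge0$. $M^*$ denotes conjugate transpose, and $Q<0$ means $Q$ is (Hermitian) negative definite. *)

(* Defs.v *)
From Stdlib Require Import Reals.
Open Scope R_scope.

Fixpoint sumR (N : nat) (f : nat -> R) : R :=
  match N with O => 0 | S N' => sumR N' f + f N' end.
Fixpoint sumN (N : nat) (f : nat -> nat) : nat :=
  match N with O => O | S N' => (sumN N' f + f N')%nat end.

Definition C := (R * R)%type.
Definition C0 : C := (0, 0).
Definition RtoC (a : R) : C := (a, 0).
Definition Cadd (x y : C) : C := (fst x + fst y, snd x + snd y).
Definition Copp (x : C) : C := (- fst x, - snd x).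
Definition Cmul (x y : C) : C :=
  (fst x * fst y - snd x * snd y, fst x * snd y + snd x * fst y).
Definition Cconj (x : C) : C := (fst x, - snd x).
Fixpoint sumC (N : nat) (f : nat -> C) : C :=
  match N with O => C0 | S N' => Cadd (sumC N' f) (f N') end.

(* ---------- matrices: entries indexed from 0; dimensions tracked
   explicitly (entries outside the dimensions are never used) ---------- *)
Definition RMat := nat -> nat -> R.
Definition CMat := nat -> nat -> C.

Definition idm : RMat := fun i j => if Nat.eqb i j then 1 else 0.
Definition radd (A B : RMat) : RMat := fun i j => A i j + B i j.
Definition rsub (A B : RMat) : RMat := fun i j => A i j - B i j.
Definition rtr (A : RMat) : RMat := fun i j => A j i.
Definition rmul (k : nat) (A B : RMat) : RMat :=
  fun i j => sumR k (fun l => A i l * B l j).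

Definition minor (p q : nat) (M : RMat) : RMat :=
  fun i j => M (if Nat.ltb i p then i else S i) (if Nat.ltb j q then j else S j).
Fixpoint det (k : nat) (M : RMat) : R :=
  match k with
  | O => 1
  | S k' => sumR (S k') (fun j => (-1) ^ j * M O j * det k' (minor O j M))
  end.
Definition rinv (k : nat) (M : RMat) : RMat :=
  fun i j => (-1) ^ (i + j) * det (k - 1) (minor j i M) / det k M.

Definition cofR (A : RMat) : CMat := fun i j => RtoC (A i j).
Definition cadd (A B : CMat) : CMat := fun i j => Cadd (A i j) (B i j).
Definition csub (A B : CMat) : CMat := fun i j => Cadd (A i j) (Copp (B i j)).
Definition ctr (A : CMat) : CMat := fun i j => Cconj (A j i).
Definition cmul (k : nat) (A B : CMat) : CMat :=
  fun i j => sumC k (fun l => Cmul (A i l) (B l j)).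
Definition czero : CMat := fun _ _ => C0.

Definition spd (n : nat) (P : RMat) : Prop :=
  (forall i j, (i < n)%nat -> (j < n)%nat -> P i j = P j i) /\
  (forall v : nat -> R, (exists k, (k < n)%nat /\ v k <> 0) ->
     0 < sumR n (fun i => sumR n (fun j => v i * P i j * v j))).

Definition hermitian (N : nat) (Q : CMat) : Prop :=
  forall i j, (i < N)%nat -> (j < N)%nat -> Q i j = Cconj (Q j i).
Definition neg_def (N : nat) (Q : CMat) : Prop :=
  hermitian N Q /\
  (forall z : nat -> C, (exists k, (k < N)%nat /\ z k <> C0) ->
     fst (sumC N (fun i => sumC N (fun j => Cmul (Cconj (z i)) (Cmul (Q i j) (z j))))) < 0).

Definition in_polytope (m nv : nat) (V : nat -> nat -> R) (th : nat -> R) : Prop :=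
  exists lam : nat -> R,
    (forall j, (j < nv)%nat -> 0 <= lam j) /\ sumR nv lam = 1 /\
    (forall k, (k < m)%nat -> th k = sumR nv (fun j => lam j * V j k)).

(* s k i = s_{(k+1) i}, k = 0..m-1 ; d_i = sum_k s_{ki} *)
Definition dim (m : nat) (s : nat -> nat -> nat) (i : nat) : nat :=
  sumN m (fun k => s k i).
Definition soff (s : nat -> nat -> nat) (i k : nat) : nat :=
  sumN k (fun k' => s k' i).
(* Delta_i(theta) = diag(theta_1 I_{s_1i}, ..., theta_m I_{s_mi}) *)
Definition Delta (m : nat) (s : nat -> nat -> nat) (i : nat) (th : nat -> R) : RMat :=
  fun p q =>
    if Nat.eqb p q then
      sumR m (fun k => if andb (Nat.leb (soff s i k) p) (Nat.ltb p (soff s i k + s k i))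
                       then th k else 0)
    else 0.

Definition DD m s (Dpq : nat -> RMat) i th : RMat :=
  rmul (dim m s i) (Dpq i) (Delta m s i th).

Definition Ai m s (A0 Bq Cp Dpq : nat -> RMat) (i : nat) (th : nat -> R) : RMat :=
  let d := dim m s i in
  radd (A0 i)
    (rmul d (rmul d (rmul d (Bq i) (Delta m s i th)) (rinv d (rsub idm (DD m s Dpq i th))))
          (Cp i)).

(* ---------- the LMI matrix Q(Delta(theta)) ----------
   Block indices: X-blocks a = 0..r (size n; X_0 is the first n-block, X_1..X_r
   form the rn-block) and W-blocks b = 0..r (size d_b, forming the d-block). *)
Definition QXX n r m s (P : RMat) (Sm A0 Cp : nat -> RMat) (G : nat -> CMat)
  (a b : nat) : CMat :=
  let d := dim m s in
  if Nat.eqb a 0 then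
    if Nat.eqb b 0 then
      cadd (cadd (cofR (radd (radd (rmul n (rtr (A0 0%nat)) P) (rmul n P (A0 0%nat)))
                             (fun i j => sumR r (fun l => Sm (S l) i j))))
                 (cmul (d 0%nat) (G 0%nat) (cofR (Cp 0%nat))))
           (cmul (d 0%nat) (cofR (rtr (Cp 0%nat))) (ctr (G 0%nat)))
    else cofR (rmul n P (A0 b))
  else if Nat.eqb b 0 then ctr (cofR (rmul n P (A0 a)))
  else if Nat.eqb a b then
    csub (cadd (cmul (d a) (G a) (cofR (Cp a))) (cmul (d a) (cofR (rtr (Cp a))) (ctr (G a))))
         (cofR (Sm a))
  else czero.

Definition QXW n m s (P : RMat) (Bq Cp Dpq : nat -> RMat) (G H : nat -> CMat)
  (th : nat -> R) (a b : nat) : CMat :=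
  let d := dim m s in
  if Nat.eqb a 0 then
    if Nat.eqb b 0 then
      cadd (csub (cadd (cofR (rmul (d 0%nat) (rmul n P (Bq 0%nat)) (Delta m s 0 th)))
                       (cmul (d 0%nat) (G 0%nat) (cofR (DD m s Dpq 0 th))))
                 (G 0%nat))
           (cmul (d 0%nat) (cofR (rtr (Cp 0%nat))) (ctr (H 0%nat)))
    else cofR (rmul (d b) (rmul n P (Bq b)) (Delta m s b th))
  else if Nat.eqb a b then
    cadd (csub (cmul (d a) (G a) (cofR (DD m s Dpq a th))) (G a))
         (cmul (d a) (cofR (rtr (Cp a))) (ctr (H a)))
  else czero.

Definition QWW m s (Dpq : nat -> RMat) (H : nat -> CMat) (th : nat -> R) (a b : nat) : CMat :=
  let d := dim m s in
  if Nat.eqb a b then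
    csub (csub (cadd (cmul (d a) (H a) (cofR (DD m s Dpq a th)))
                     (cmul (d a) (cofR (rtr (DD m s Dpq a th))) (ctr (H a))))
               (H a))
         (ctr (H a))
  else czero.

Definition place (r0 rs c0 cs : nat) (M : CMat) : CMat :=
  fun k l =>
    if andb (andb (Nat.leb r0 k) (Nat.ltb k (r0 + rs)))
            (andb (Nat.leb c0 l) (Nat.ltb l (c0 + cs)))
    then M (k - r0)%nat (l - c0)%nat else C0.

Definition xoff (n a : nat) : nat := (a * n)%nat.
Definition woff (n r m : nat) s (b : nat) : nat :=
  (n * (r + 1) + sumN b (dim m s))%nat.

Definition Qsize (n r m : nat) s : nat := (n * (r + 1) + sumN (r + 1) (dim m s))%nat.

Definition Qmat n r m s (P : RMat) (Sm A0 Bq Cp Dpq : nat -> RMat) (G H : nat -> CMat)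
  (th : nat -> R) : CMat :=
  let d := dim m s in
  fun k l =>
    sumC (r + 1) (fun a => sumC (r + 1) (fun b =>
      Cadd (Cadd (place (xoff n a) n (xoff n b) n (QXX n r m s P Sm A0 Cp G a b) k l)
                 (place (xoff n a) n (woff n r m s b) (d b)
                        (QXW n m s P Bq Cp Dpq G H th a b) k l))
           (Cadd (place (woff n r m s a) (d a) (xoff n b) n
                        (ctr (QXW n m s P Bq Cp Dpq G H th b a)) k l)
                 (place (woff n r m s a) (d a) (woff n r m s b) (d b)
                        (QWW m s Dpq H th a b) k l)))).

Fixpoint hmax (r : nat) (h : nat -> R) : R :=
  match r with O => h O | S r' => Rmax (hmax r' h) (h (S r')) end.

Definition rhs n r m s (A0 Bq Cp Dpq : nat -> RMat) (h : nat -> R)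
  (th : R -> nat -> R) (x : R -> nat -> R) (t : R) (k : nat) : R :=
  sumR (r + 1) (fun i => sumR n (fun l => Ai m s A0 Bq Cp Dpq i (th t) k l * x (t - h i) l)).

Definition abs_cont_on (a b : R) (f : R -> R) : Prop :=
  forall eps, 0 < eps -> exists delta, 0 < delta /\
    forall (N : nat) (u v : nat -> R),
      (forall j, (j < N)%nat -> a <= u j /\ u j <= v j /\ v j <= b) ->
      (forall j, (S j < N)%nat -> v j <= u (S j)) ->
      sumR N (fun j => v j - u j) < delta ->
      sumR N (fun j => Rabs (f (v j) - f (u j))) < eps.

Definition null_set (E : R -> Prop) : Prop :=
  forall eps, 0 < eps -> exists a b : nat -> R,
    (forall k, a k <= b k) /\
    (forall t, E t -> exists k, a k < t < b k) /\
    (forall N, sumR N (fun k => b k - a k) <= eps).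

(* Caratheodory solution on [-h, oo): x absolutely continuous on every [-h, T]
   (so x|[-h,0] is an absolutely continuous initial function), and the delay
   equation holds for almost every t > 0. *)
Definition is_solution n r m s (A0 Bq Cp Dpq : nat -> RMat) (h : nat -> R)
  (th : R -> nat -> R) (x : R -> nat -> R) : Prop :=
  (forall T, 0 < T -> forall k, (k < n)%nat -> abs_cont_on (- hmax r h) T (fun t => x t k)) /\
  null_set (fun t => 0 < t /\
     ~ (forall k, (k < n)%nat ->
          derivable_pt_lim (fun u => x u k) t (rhs n r m s A0 Bq Cp Dpq h th x t k))).

Definition vnorm (n : nat) (v : nat -> R) : R := sqrt (sumR n (fun k => v k ^ 2)).

Definition GAS_indep_delays n r m (Theta : (nat -> R) -> Prop) s
  (A0 Bq Cp Dpq : nat -> RMat) : Prop :=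
  forall h : nat -> R, h 0%nat = 0 -> (forall i, (1 <= i <= r)%nat -> 0 <= h i) ->
  forall th : R -> nat -> R, (forall t, 0 <= t -> Theta (th t)) ->
  forall x : R -> nat -> R, is_solution n r m s A0 Bq Cp Dpq h th x ->
    (exists M, forall t, 0 <= t -> vnorm n (x t) <= M) /\
    (forall eps, 0 < eps -> exists T, forall t, T <= t -> vnorm n (x t) < eps).

(* Main.v *)
(** For [w_i = (I - D_i Delta_i)^{-1} C_i x_i] the multipliers [G_i], [H_i] drop out of the quadratic
    form of [Q] at the real vector [(x_0, ..., x_r, w_0, ..., w_r)], because each of them multiplies
    [C_i x_i + D_i Delta_i w_i - w_i = 0]; what remains is
    [2 x_0^T P (sum_i A_i(theta) x_i) + sum_i x_0^T S_i x_0 - sum_i x_i^T S_i x_i].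
    It does not involve [G], [H], so it is continuous in [theta], and by compactness of the polytope
    it is at most [- eps |x_0|^2] with [eps] independent of [theta].  With [x_i = x(t - h_i)] it is
    the derivative of the Lyapunov-Krasovskii functional
    [x^T P x + sum_i int_{t-h_i}^t x^T S_i x], which therefore bounds [|x|] and [int |x|^2].
    Finally [(x^T P x)' <= sum_i x(t-h_i)^T S_i x(t-h_i)] is bounded above, and a one-sided form of
    Barbalat's lemma gives convergence to [0]. *)

Require Import Defs.
From mathcomp Require all_boot all_algebra Rstruct.
From Coquelicot Require Coquelicot.
From Stdlib Require Import Reals Lra Lia Classical IndefiniteDescription FunctionalExtensionality.
Open Scope R_scope.

(** * Determinant and inverse *)

(** The parameter trajectory carries no regularity in time, and the delay equation holds only off a
    null set. Hence nothing depending on [theta(t)] is ever integrated: the bound on the derivative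
    is used pointwise, and the only integrals are Riemann integrals of the continuous functions
    [x^T S_i x] and [|x|^2]. The fundamental theorem of calculus is replaced by the fact that an
    absolutely continuous function with nonpositive derivative off a null set does not increase,
    proved directly from the definitions of the two notions. The one-sided bound in Barbalat's lemma
    suits this setting: it comes from the sign of the reduced form and the boundedness of [x],
    without any estimate of the matrices [A_i(theta)]. Compactness is applied to barycentric
    coordinates times the unit sphere of stacked states, the form being homogeneous of degree 2.
    Solutions are extended by a constant to the left of [-h], so that the primitives live on the
    whole line. *)

Section Determinant.
Import all_boot all_algebra Rstruct GRing.Theory.

Lemma sumR_big N f : sumR N f = (\sum_(i < N) f i)%R.
Proof. by elim: N => [|N IH] /=; rewrite ?big_ord0 // big_ord_recr /= IH. Qed.

Lemma minor_mxE k (i j : 'I_k.+1) M :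
  (\matrix_(a < k, b < k) minor i j M a b
   = row' i (col' j (\matrix_(a < k.+1, b < k.+1) M a b)))%R.
Proof.
apply/matrixP => a b; rewrite !mxE /minor /=.
have bumpE h l : (if Nat.ltb l h then l else l.+1) = bump h l.
  by rewrite /bump leqNgt; case: Nat.ltb_spec => [/ltP -> // | /leP]; rewrite leqNgt => ->.
by rewrite !bumpE.
Qed.

(** Both determinants expand along the first row, the first by definition and the second by
    [expand_det_row]; the minors agree by [minor_mxE]. *)
Lemma det_mxE k M : det k M = (\det (\matrix_(i < k, j < k) M i j))%R.
Proof.
elim: k M => [|k IH] M; first by rewrite det_mx00.
rewrite (expand_det_row _ ord0) /det -/det sumR_big; apply: eq_bigr => j _.
rewrite IH (minor_mxE k ord0 j) [in RHS]mxE /cofactor add0n RpowE mulrA.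
by congr (_ * _)%R; rewrite mulrC.
Qed.

(** [rinv] is the adjugate over the determinant, so this is [mul_mx_adj] read entrywise. *)
Lemma rmul_rinv k M i j :
  det k M <> IZR 0 -> (i < k)%coq_nat -> (j < k)%coq_nat -> rmul k M (rinv k M) i j = idm i j.
Proof.
case: k => [_ /ltP // | k det0 /ltP ik /ltP jk].
pose A := (\matrix_(a < k.+1, b < k.+1) M a b)%R.
have := congr1 (fun B : 'M_k.+1 => B (Ordinal ik) (Ordinal jk)) (mul_mx_adj A).
rewrite !mxE -[(\det A)%R]det_mxE => E.
have {}E : (\sum_(l < k.+1) M i l * ((-1) ^+ (l + j) * det k (minor j l M))
   = det k.+1 M *+ (Ordinal ik == Ordinal jk))%R.
  rewrite -E; apply: eq_bigr => l _; rewrite !mxE /cofactor det_mxE.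
  by rewrite (minor_mxE k (Ordinal jk) l) addnC.
rewrite /rmul sumR_big.
transitivity ((det k.+1 M *+ (Ordinal ik == Ordinal jk)) / det k.+1 M)%R.
  rewrite -E mulr_suml; apply: eq_bigr => l _.
  rewrite /rinv RpowE RdivE (_ : Nat.sub k.+1 1 = k); last exact: Nat.sub_0_r.
  by rewrite -!mulrA.
rewrite -(inj_eq val_inj) /= /idm.
have -> : (i == j) = Nat.eqb i j by apply/eqP/idP => /Nat.eqb_spec.
by case: Nat.eqb; rewrite ?mul0r // mulr1n divff //; apply/eqP.
Qed.

End Determinant.

(** * The quadratic form of the LMI *)

Lemma sumR_ext N f g : (forall i, (i < N)%nat -> f i = g i) -> sumR N f = sumR N g.
Proof.
  induction N as [|N IH]; simpl; intros E; [easy|].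
  rewrite IH by (intros; apply E; lia). rewrite E by lia. easy.
Qed.

Lemma sumR_0 N f : (forall i, (i < N)%nat -> f i = 0) -> sumR N f = 0.
Proof.
  induction N as [|N IH]; simpl; intros E; [easy|].
  rewrite IH by (intros; apply E; lia). rewrite E by lia. lra.
Qed.

Lemma sumR_plus N f g : sumR N (fun i => f i + g i) = sumR N f + sumR N g.
Proof. induction N as [|N IH]; simpl; [|rewrite IH]; lra. Qed.

Lemma sumR_minus N f g : sumR N (fun i => f i - g i) = sumR N f - sumR N g.
Proof. induction N as [|N IH]; simpl; [|rewrite IH]; lra. Qed.

Lemma sumR_scal N c f : sumR N (fun i => c * f i) = c * sumR N f.
Proof. induction N as [|N IH]; simpl; [|rewrite IH]; lra. Qed.

Lemma sumR_le N f g : (forall i, (i < N)%nat -> f i <= g i) -> sumR N f <= sumR N g.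
Proof.
  induction N as [|N IH]; simpl; intros E; [lra|].
  apply Rplus_le_compat; [apply IH; intros; apply E|apply E]; lia.
Qed.

Lemma sumR_nonneg N f : (forall i, (i < N)%nat -> 0 <= f i) -> 0 <= sumR N f.
Proof. intros E. rewrite <- (sumR_0 N (fun _ => 0)) by easy. apply sumR_le, E. Qed.

Lemma sumR_term_le N f i :
  (forall j, (j < N)%nat -> 0 <= f j) -> (i < N)%nat -> f i <= sumR N f.
Proof.
  induction N as [|N IH]; simpl; intros E iN; [lia|].
  assert (0 <= f N) by (apply E; lia).
  assert (0 <= sumR N f) by (apply sumR_nonneg; intros; apply E; lia).
  destruct (Nat.eq_dec i N) as [->|]; [lra|].
  enough (f i <= sumR N f) by lra. apply IH; [intros; apply E|]; lia.
Qed.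

Lemma sumR_swap N M f :
  sumR N (fun i => sumR M (fun j => f i j)) = sumR M (fun j => sumR N (fun i => f i j)).
Proof.
  induction N as [|N IH]; simpl; [now rewrite sumR_0|].
  now rewrite IH, <- sumR_plus.
Qed.

Lemma sumR_app a b f : sumR (a + b) f = sumR a f + sumR b (fun i => f (a + i)%nat).
Proof.
  induction b as [|b IH]; simpl; [rewrite Nat.add_0_r; lra|].
  rewrite Nat.add_succ_r; simpl; rewrite IH; lra.
Qed.

Lemma sumR_shift N f : sumR (S N) f = f O + sumR N (fun i => f (S i)).
Proof. rewrite (sumR_app 1 N). simpl. lra. Qed.

Lemma sumR_window N a b f : (a + b <= N)%nat ->
  sumR N (fun k => if andb (Nat.leb a k) (Nat.ltb k (a + b)) then f k else 0)
  = sumR b (fun i => f (a + i)%nat).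
Proof.
  intros H. replace N with (a + b + (N - (a + b)))%nat by lia. rewrite !sumR_app.
  rewrite (sumR_0 a), (sumR_0 (N - (a + b))).
  - rewrite Rplus_0_l, Rplus_0_r. apply sumR_ext. intros i Hi.
    destruct (Nat.leb_spec a (a + i)), (Nat.ltb_spec (a + i) (a + b)); simpl; lia || easy.
  - intros i Hi. destruct (Nat.ltb_spec (a + b + i) (a + b)); [lia|].
    now rewrite Bool.andb_false_r.
  - intros i Hi. destruct (Nat.leb_spec a i); [lia|easy].
Qed.

Lemma sumR_diag N f : (forall a b, a <> b -> f a b = 0) ->
  sumR N (fun a => sumR N (fun b => f a b)) = sumR N (fun a => f a a).
Proof.
  intros D. induction N as [|N IH]; simpl; [easy|].
  rewrite sumR_plus, IH.
  rewrite (sumR_0 N (fun i => f i N)), (sumR_0 N (fun b => f N b)); [lra| |];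
    intros; apply D; lia.
Qed.

(** * Bilinear forms with explicit dimensions *)

Definition mv k (M : RMat) (v : nat -> R) : nat -> R := fun i => sumR k (fun l => M i l * v l).

Definition bil p q (M : RMat) (u v : nat -> R) : R :=
  sumR p (fun i => sumR q (fun j => u i * M i j * v j)).

Lemma bil_ext p q M M' u u' v v' :
  (forall i j, (i < p)%nat -> (j < q)%nat -> M i j = M' i j) ->
  (forall i, (i < p)%nat -> u i = u' i) -> (forall j, (j < q)%nat -> v j = v' j) ->
  bil p q M u v = bil p q M' u' v'.
Proof.
  intros E Eu Ev. apply sumR_ext; intros i Hi. apply sumR_ext; intros j Hj.
  now rewrite E, Eu, Ev.
Qed.

Lemma bil_mv p q M u v : bil p q M u v = sumR p (fun i => u i * mv q M v i).
Proof.
  apply sumR_ext; intros i _. unfold mv. rewrite <- sumR_scal.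
  apply sumR_ext; intros; ring.
Qed.

Lemma bil_radd p q A B u v : bil p q (radd A B) u v = bil p q A u v + bil p q B u v.
Proof.
  unfold bil, radd. rewrite <- sumR_plus. apply sumR_ext; intros.
  rewrite <- sumR_plus. apply sumR_ext; intros. ring.
Qed.

Lemma bil_rsub p q A B u v : bil p q (rsub A B) u v = bil p q A u v - bil p q B u v.
Proof.
  unfold bil, rsub. rewrite <- sumR_minus. apply sumR_ext; intros.
  rewrite <- sumR_minus. apply sumR_ext; intros. ring.
Qed.

Lemma bil_sumR p q K (A : nat -> RMat) u v :
  bil p q (fun i j => sumR K (fun a => A a i j)) u v = sumR K (fun a => bil p q (A a) u v).
Proof.
  unfold bil. rewrite (sumR_swap K p). apply sumR_ext; intros i _.
  rewrite (sumR_swap K q). apply sumR_ext; intros j _.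
  rewrite <- sumR_scal, Rmult_comm, <- sumR_scal. apply sumR_ext; intros. ring.
Qed.

Lemma bil_rtr p q A u v : bil p q (rtr A) u v = bil q p A v u.
Proof.
  unfold bil, rtr. rewrite sumR_swap. apply sumR_ext; intros. apply sumR_ext; intros. ring.
Qed.

Lemma bil_vadd p q A u v w :
  bil p q A u (fun i => v i + w i) = bil p q A u v + bil p q A u w.
Proof.
  unfold bil. rewrite <- sumR_plus. apply sumR_ext; intros.
  rewrite <- sumR_plus. apply sumR_ext; intros. ring.
Qed.

Lemma bil_vsum p q A u K (v : nat -> nat -> R) :
  bil p q A u (fun i => sumR K (fun a => v a i)) = sumR K (fun a => bil p q A u (v a)).
Proof.
  unfold bil. rewrite (sumR_swap K p). apply sumR_ext; intros i _.
  rewrite (sumR_swap K q). apply sumR_ext; intros j _. now rewrite <- sumR_scal.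
Qed.

Lemma bil_0 p q A u v :
  (forall i j, (i < p)%nat -> (j < q)%nat -> A i j = 0) -> bil p q A u v = 0.
Proof.
  intros E. apply sumR_0; intros. apply sumR_0; intros. rewrite E by easy. ring.
Qed.

Lemma mv_radd k A B v i : mv k (radd A B) v i = mv k A v i + mv k B v i.
Proof. unfold mv, radd. rewrite <- sumR_plus. apply sumR_ext; intros. ring. Qed.

Lemma mv_rsub k A B v i : mv k (rsub A B) v i = mv k A v i - mv k B v i.
Proof. unfold mv, rsub. rewrite <- sumR_minus. apply sumR_ext; intros. ring. Qed.

Lemma mv_rmul q k A B v i : mv q (rmul k A B) v i = mv k A (mv q B v) i.
Proof.
  unfold mv, rmul.
  transitivity (sumR q (fun j => sumR k (fun l => A i l * (B l j * v j)))).
  - apply sumR_ext; intros. rewrite Rmult_comm, <- sumR_scal.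
    apply sumR_ext; intros; ring.
  - rewrite sumR_swap. apply sumR_ext; intros. now rewrite sumR_scal.
Qed.

Lemma mv_ext k A A' v v' i : (forall l, (l < k)%nat -> A i l = A' i l) ->
  (forall l, (l < k)%nat -> v l = v' l) -> mv k A v i = mv k A' v' i.
Proof. intros E E'. apply sumR_ext; intros. now rewrite E, E'. Qed.

Lemma mv_idm k v i : (i < k)%nat -> mv k idm v i = v i.
Proof.
  intros ik. unfold mv.
  transitivity (sumR k (fun l => if andb (Nat.leb i l) (Nat.ltb l (i + 1)) then v l else 0)).
  - apply sumR_ext; intros l _. unfold idm.
    destruct (Nat.eqb_spec i l), (Nat.leb_spec i l), (Nat.ltb_spec l (i + 1)); simpl; lia || ring.
  - rewrite sumR_window by lia. simpl. rewrite Nat.add_0_r. ring.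
Qed.

Lemma bil_rmul p q k A B u v : bil p q (rmul k A B) u v = bil p k A u (mv q B v).
Proof. rewrite !bil_mv. apply sumR_ext; intros. now rewrite mv_rmul. Qed.

(** At real vectors the real part of a form sees only the real parts of the entries. On these, [ctr]
    is plain transposition, and a complex product with one real factor becomes a real product; no
    imaginary part of [G] or [H] survives. *)
Definition reM (M : CMat) : RMat := fun i j => fst (M i j).

Lemma fst_sumC N f : fst (sumC N f) = sumR N (fun i => fst (f i)).
Proof. induction N as [|N IH]; simpl; [easy|now rewrite IH]. Qed.

Lemma bil_cadd p q A B u v :
  bil p q (reM (cadd A B)) u v = bil p q (reM A) u v + bil p q (reM B) u v.
Proof. exact (bil_radd p q (reM A) (reM B) u v). Qed.

Lemma bil_csub p q A B u v :
  bil p q (reM (csub A B)) u v = bil p q (reM A) u v - bil p q (reM B) u v.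
Proof. exact (bil_rsub p q (reM A) (reM B) u v). Qed.

Lemma bil_ctr p q A u v : bil p q (reM (ctr A)) u v = bil q p (reM A) v u.
Proof. exact (bil_rtr p q (reM A) u v). Qed.

Lemma bil_cofR p q A u v : bil p q (reM (cofR A)) u v = bil p q A u v.
Proof. easy. Qed.

Lemma bil_czero p q u v : bil p q (reM czero) u v = 0.
Proof. now apply bil_0. Qed.

Lemma bil_cmul_cofR p q k A B u v :
  bil p q (reM (cmul k A (cofR B))) u v = bil p k (reM A) u (mv q B v).
Proof.
  rewrite <- bil_rmul. apply bil_ext; try easy. intros i j _ _.
  unfold reM, cmul, rmul. rewrite fst_sumC. apply sumR_ext; intros; simpl; ring.
Qed.

(** [A^T B^*] is the adjoint of [B A], so at real vectors it gives the form of [B A] with the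
    arguments exchanged. *)
Lemma bil_cmul_rtr_ctr p q k A B u v :
  bil p q (reM (cmul k (cofR (rtr A)) (ctr B))) u v = bil q k (reM B) v (mv p A u).
Proof.
  rewrite <- bil_rmul, <- bil_rtr. apply bil_ext; try easy. intros i j _ _.
  unfold reM, cmul, rmul, rtr. rewrite fst_sumC. apply sumR_ext; intros; simpl; ring.
Qed.

(** * Blocks of the full matrix and stacked test vectors *)

Lemma bil_place N r0 rs c0 cs M z :
  (r0 + rs <= N)%nat -> (c0 + cs <= N)%nat ->
  bil N N (reM (place r0 rs c0 cs M)) z z
  = bil rs cs (reM M) (fun i => z (r0 + i)%nat) (fun j => z (c0 + j)%nat).
Proof.
  intros Hr Hc. unfold bil.
  transitivity (sumR N (fun k => if andb (Nat.leb r0 k) (Nat.ltb k (r0 + rs)) then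
     sumR N (fun l => if andb (Nat.leb c0 l) (Nat.ltb l (c0 + cs)) then
       z k * reM M (k - r0)%nat (l - c0)%nat * z l else 0) else 0)).
  - apply sumR_ext; intros k _. unfold reM, place.
    destruct (andb (Nat.leb r0 k) (Nat.ltb k (r0 + rs))).
    + apply sumR_ext; intros l _.
      destruct (andb (Nat.leb c0 l) (Nat.ltb l (c0 + cs))); simpl; ring.
    + apply sumR_0; intros; simpl; ring.
  - rewrite sumR_window by easy. apply sumR_ext; intros i _.
    rewrite sumR_window by easy. apply sumR_ext; intros j _.
    now rewrite !(Nat.add_comm r0), !(Nat.add_comm c0), !Nat.add_sub.
Qed.

Lemma sumN_block K e b : (b < K)%nat -> (sumN b e + e b <= sumN K e)%nat.
Proof.
  induction K as [|K IH]; intros H; [lia|]. simpl.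
  destruct (Nat.eq_dec b K) as [->|]; lia.
Qed.

Lemma sumN_const K c : sumN K (fun _ => c) = (K * c)%nat.
Proof. induction K as [|K IH]; simpl; lia. Qed.

Lemma stack_blocks K e (w : nat -> nat -> R) :
  exists z, forall b j, (b < K)%nat -> (j < e b)%nat -> z (sumN b e + j)%nat = w b j.
Proof.
  induction K as [|K [z Hz]]; [exists (fun _ => 0); intros; lia|].
  exists (fun k => if Nat.ltb k (sumN K e) then z k else w K (k - sumN K e)%nat).
  intros b j Hb Hj. destruct (Nat.eq_dec b K) as [->|].
  - destruct (Nat.ltb_spec (sumN K e + j) (sumN K e)); [lia|].
    f_equal. lia.
  - pose proof (sumN_block K e b ltac:(lia)).
    destruct (Nat.ltb_spec (sumN b e + j) (sumN K e)); [|lia].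
    apply Hz; lia.
Qed.

Lemma quadratic_form_real N Q z :
  fst (sumC N (fun i => sumC N (fun j => Cmul (Cconj (RtoC (z i))) (Cmul (Q i j) (RtoC (z j))))))
  = bil N N (reM Q) z z.
Proof.
  rewrite fst_sumC. apply sumR_ext; intros i _.
  rewrite fst_sumC. apply sumR_ext; intros j _. unfold reM; simpl; ring.
Qed.

(* The derivative of the Lyapunov-Krasovskii functional when [x i] is the state at time [t - h i]. *)
Definition LK n r (P : RMat) (Sm A : nat -> RMat) (x : nat -> nat -> R) : R :=
  2 * sumR (S r) (fun i => bil n n P (x O) (mv n (A i) (x i)))
  + sumR r (fun l => bil n n (Sm (S l)) (x O) (x O))
  - sumR r (fun l => bil n n (Sm (S l)) (x (S l)) (x (S l))).

(** * Elimination of the multipliers *)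

Section ReducedForm.

Variables (n r m : nat) (s : nat -> nat -> nat) (A0 Bq Cp Dpq : nat -> RMat).
Variables (P : RMat) (Sm : nat -> RMat) (G H : nat -> CMat) (th : nat -> R).
Variable x : nat -> nat -> R.

Hypothesis Psym : forall i j, (i < n)%nat -> (j < n)%nat -> P i j = P j i.
Hypothesis wellposed : forall i, (i <= r)%nat ->
  det (dim m s i) (rsub idm (DD m s Dpq i th)) <> 0.

Let d := dim m s.

Let w i := mv (d i) (rinv (d i) (rsub idm (DD m s Dpq i th))) (mv n (Cp i) (x i)).

(** Applying [I - D Delta] to [w] cancels its right inverse. The result is the constraint to which
    every multiplier is attached. *)
Lemma w_eq i j : (i <= r)%nat -> (j < d i)%nat ->
  w i j = mv (d i) (DD m s Dpq i th) (w i) j + mv n (Cp i) (x i) j.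
Proof.
  intros Hi Hj.
  enough (E : mv (d i) (rsub idm (DD m s Dpq i th)) (w i) j = mv n (Cp i) (x i) j).
  { rewrite mv_rsub, mv_idm in E by easy. lra. }
  unfold w at 1. rewrite <- mv_rmul, <- (mv_idm (d i) (mv n (Cp i) (x i))) by easy.
  apply mv_ext; [|easy]. intros l Hl. apply rmul_rinv; [apply wellposed|..]; easy.
Qed.

Lemma bil_sym u v : bil n n P u v = bil n n P v u.
Proof.
  rewrite <- bil_rtr. apply bil_ext; try easy. intros. now apply Psym.
Qed.

Lemma bil_w p i M u : (i <= r)%nat ->
  bil p (d i) M u (w i)
  = bil p (d i) M u (mv (d i) (DD m s Dpq i th) (w i)) + bil p (d i) M u (mv n (Cp i) (x i)).
Proof.
  intros Hi. rewrite <- bil_vadd. apply bil_ext; try easy. intros; now apply w_eq.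
Qed.

(** [B Delta w] is the parameter-dependent part of [A_i x_i], by the definition of [w]. *)
Lemma bil_Ai u i :
  bil n n P u (mv n (Ai m s A0 Bq Cp Dpq i th) (x i))
  = bil n n P u (mv n (A0 i) (x i))
    + bil n (d i) (rmul (d i) (rmul n P (Bq i)) (Defs.Delta m s i th)) u (w i).
Proof.
  rewrite !bil_rmul, <- bil_vadd. apply bil_ext; try easy. intros j _.
  unfold Ai. rewrite mv_radd, !mv_rmul. f_equal.
Qed.

(** The [G] terms left over here carry the factor 2 with which they cancel: [form_XW] contains them
    once with a minus sign and enters twice, for the upper and the lower off-diagonal blocks. Its
    [H] terms cancel against [form_WW] in the same way. *)
Lemma form_XX :
  sumR (S r) (fun a => sumR (S r) (fun b =>
    bil n n (reM (QXX n r m s P Sm A0 Cp G a b)) (x a) (x b)))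
  = 2 * sumR (S r) (fun i => bil n n P (x O) (mv n (A0 i) (x i)))
  + sumR r (fun l => bil n n (Sm (S l)) (x O) (x O))
  - sumR r (fun l => bil n n (Sm (S l)) (x (S l)) (x (S l)))
  + 2 * sumR (S r) (fun i => bil n (d i) (reM (G i)) (x i) (mv n (Cp i) (x i))).
Proof.
  rewrite !sumR_shift.
  rewrite (sumR_ext r (fun i => sumR (S r) _) (fun i =>
    bil n n P (x O) (mv n (A0 (S i)) (x (S i))) +
    sumR r (fun j => bil n n (reM (QXX n r m s P Sm A0 Cp G (S i) (S j))) (x (S i)) (x (S j))))).
  2:{ intros i _. rewrite sumR_shift. f_equal.
      unfold QXX; simpl. now rewrite bil_ctr, bil_cofR, bil_rmul. }
  rewrite sumR_plus, sumR_diag.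
  2:{ intros a b ab. unfold QXX; simpl. destruct (Nat.eqb_spec a b); [easy|]. apply bil_czero. }
  rewrite (sumR_ext r (fun i => bil n n (reM _) (x O) _)
    (fun i => bil n n P (x O) (mv n (A0 (S i)) (x (S i))))).
  2:{ intros i _. unfold QXX; simpl. now rewrite bil_cofR, bil_rmul. }
  rewrite (sumR_ext r (fun a => bil n n (reM _) (x (S a)) _)
    (fun i => 2 * bil n (d (S i)) (reM (G (S i))) (x (S i)) (mv n (Cp (S i)) (x (S i)))
       - bil n n (Sm (S i)) (x (S i)) (x (S i)))).
  2:{ intros i _. unfold QXX; simpl. rewrite Nat.eqb_refl.
      rewrite bil_csub, bil_cadd, bil_cmul_cofR, bil_cmul_rtr_ctr, bil_cofR. fold d. ring. }
  rewrite sumR_minus, sumR_scal.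
  unfold QXX at 1; simpl.
  rewrite !bil_cadd, bil_cmul_cofR, bil_cmul_rtr_ctr, bil_cofR, !bil_radd, (bil_sumR n n r (fun l => Sm (S l))), !bil_rmul.
  (* Symmetry of [P] turns both halves of [A^T P + P A] into the same sum [(A x)^T (P x)]. *)
  rewrite bil_rtr, (bil_sym (x O) (mv n (A0 O) (x O))), (bil_mv n n (A0 O)), (bil_mv n n P (mv _ _ _)).
  rewrite (sumR_ext n (fun i => mv n P (x O) i * _) (fun i => mv n (A0 O) (x O) i * mv n P (x O) i))
    by (intros; ring).
  fold d. ring.
Qed.

Lemma form_XW :
  sumR (S r) (fun a => sumR (S r) (fun b =>
    bil n (d b) (reM (QXW n m s P Bq Cp Dpq G H th a b)) (x a) (w b)))
  = sumR (S r) (fun i => bil n (d i) (rmul (d i) (rmul n P (Bq i)) (Defs.Delta m s i th)) (x O) (w i))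
  - sumR (S r) (fun i => bil n (d i) (reM (G i)) (x i) (mv n (Cp i) (x i)))
  + sumR (S r) (fun i => bil (d i) (d i) (reM (H i)) (w i) (mv n (Cp i) (x i))).
Proof.
  (* This part is common to all diagonal blocks. By [bil_w], [G D Delta w - G w] collapses to
     [- G C x]. *)
  assert (E : forall i, (i <= r)%nat ->
    bil n (d i) (reM (cadd (csub (cmul (d i) (G i) (cofR (DD m s Dpq i th))) (G i))
         (cmul (d i) (cofR (rtr (Cp i))) (ctr (H i))))) (x i) (w i)
    = bil (d i) (d i) (reM (H i)) (w i) (mv n (Cp i) (x i))
      - bil n (d i) (reM (G i)) (x i) (mv n (Cp i) (x i))).
  { intros i Hi.
    rewrite bil_cadd, bil_csub, bil_cmul_cofR, bil_cmul_rtr_ctr, (bil_w n i _ _ Hi). ring. }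
  rewrite !sumR_shift.
  rewrite (sumR_ext r (fun i => sumR (S r) _) (fun i =>
    sumR r (fun j => bil n (d (S j)) (reM (QXW n m s P Bq Cp Dpq G H th (S i) (S j)))
      (x (S i)) (w (S j))))).
  2:{ intros i _. rewrite sumR_shift. unfold QXW at 1; simpl. rewrite bil_czero. ring. }
  rewrite sumR_diag.
  2:{ intros a b ab. unfold QXW; simpl. destruct (Nat.eqb_spec a b); [easy|]. apply bil_czero. }
  rewrite (sumR_ext r (fun a => bil n (d (S a)) (reM _) (x (S a)) _)
    (fun i => bil (d (S i)) (d (S i)) (reM (H (S i))) (w (S i)) (mv n (Cp (S i)) (x (S i)))
      - bil n (d (S i)) (reM (G (S i))) (x (S i)) (mv n (Cp (S i)) (x (S i))))).
  2:{ intros i Hi. rewrite <- E by lia. unfold QXW; simpl. now rewrite Nat.eqb_refl. }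
  rewrite sumR_minus.
  assert (E0 := E O ltac:(lia)).
  rewrite bil_cadd, bil_csub in E0. unfold QXW; simpl. fold d.
  rewrite bil_cadd, bil_csub, bil_cadd, bil_cofR.
  rewrite (sumR_ext r (fun i => bil n _ (reM (cofR _)) (x O) _) (fun i =>
    bil n (d (S i)) (rmul (d (S i)) (rmul n P (Bq (S i))) (Defs.Delta m s (S i) th)) (x O) (w (S i))))
    by easy.
  lra.
Qed.

(** At real vectors a diagonal block gives [2 w^T H (D Delta w - w)], and
    [D Delta w - w = - C x]. *)
Lemma form_WW :
  sumR (S r) (fun a => sumR (S r) (fun b =>
    bil (d a) (d b) (reM (QWW m s Dpq H th a b)) (w a) (w b)))
  = - 2 * sumR (S r) (fun i => bil (d i) (d i) (reM (H i)) (w i) (mv n (Cp i) (x i))).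
Proof.
  rewrite sumR_diag.
  2:{ intros a b ab. unfold QWW; simpl. destruct (Nat.eqb_spec a b); [easy|]. apply bil_czero. }
  rewrite <- sumR_scal. apply sumR_ext. intros i Hi.
  unfold QWW. rewrite Nat.eqb_refl. fold d.
  rewrite !bil_csub, bil_cadd, bil_cmul_cofR, bil_cmul_rtr_ctr, bil_ctr.
  rewrite (bil_w _ i (reM (H i)) (w i)) by lia. ring.
Qed.

Lemma form_LK z :
  (forall a i, (a <= r)%nat -> (i < n)%nat -> z (xoff n a + i)%nat = x a i) ->
  (forall b j, (b <= r)%nat -> (j < d b)%nat -> z (woff n r m s b + j)%nat = w b j) ->
  let N := Qsize n r m s in
  bil N N (reM (Qmat n r m s P Sm A0 Bq Cp Dpq G H th)) z z
  = LK n r P Sm (fun i => Ai m s A0 Bq Cp Dpq i th) x.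
Proof.
  intros Hx Hw N.
  assert (Nx : forall a, (a <= r)%nat -> (xoff n a + n <= N)%nat).
  { intros a Ha. unfold N, Qsize, xoff. nia. }
  assert (Nw : forall b, (b <= r)%nat -> (woff n r m s b + d b <= N)%nat).
  { intros b Hb. unfold N, Qsize, woff.
    pose proof (sumN_block (r + 1) (dim m s) b ltac:(lia)). unfold d. lia. }
  transitivity (sumR (r + 1) (fun a => sumR (r + 1) (fun b =>
    (bil n n (reM (QXX n r m s P Sm A0 Cp G a b)) (x a) (x b)
     + bil n (d b) (reM (QXW n m s P Bq Cp Dpq G H th a b)) (x a) (w b))
    + (bil n (d a) (reM (QXW n m s P Bq Cp Dpq G H th b a)) (x b) (w a)
     + bil (d a) (d b) (reM (QWW m s Dpq H th a b)) (w a) (w b))))).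
  { transitivity (sumR (r + 1) (fun a => bil N N (fun k l => sumR (r + 1) (fun b => fst (
      Cadd (Cadd (place (xoff n a) n (xoff n b) n (QXX n r m s P Sm A0 Cp G a b) k l)
                 (place (xoff n a) n (woff n r m s b) (d b)
                        (QXW n m s P Bq Cp Dpq G H th a b) k l))
           (Cadd (place (woff n r m s a) (d a) (xoff n b) n
                        (ctr (QXW n m s P Bq Cp Dpq G H th b a)) k l)
                 (place (woff n r m s a) (d a) (woff n r m s b) (d b)
                        (QWW m s Dpq H th a b) k l))))) z z)).
    { rewrite <- bil_sumR. apply bil_ext; try easy. intros i j _ _.
      unfold reM, Qmat. rewrite fst_sumC. apply sumR_ext; intros. now rewrite fst_sumC. }
    apply sumR_ext; intros a Ha. rewrite bil_sumR.
    apply sumR_ext; intros b Hb.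
    (* Up to conversion the summand is the real part of a sum of four placed matrices, so the block
       lemmas apply. *)
    change (bil N N (reM (cadd (cadd (place (xoff n a) n (xoff n b) n (QXX n r m s P Sm A0 Cp G a b))
                 (place (xoff n a) n (woff n r m s b) (d b) (QXW n m s P Bq Cp Dpq G H th a b)))
           (cadd (place (woff n r m s a) (d a) (xoff n b) n
                        (ctr (QXW n m s P Bq Cp Dpq G H th b a)))
                 (place (woff n r m s a) (d a) (woff n r m s b) (d b)
                        (QWW m s Dpq H th a b))))) z z = bil n n (reM (QXX n r m s P Sm A0 Cp G a b)) (x a) (x b)
     + bil n (d b) (reM (QXW n m s P Bq Cp Dpq G H th a b)) (x a) (w b)
    + (bil n (d a) (reM (QXW n m s P Bq Cp Dpq G H th b a)) (x b) (w a)
     + bil (d a) (d b) (reM (QWW m s Dpq H th a b)) (w a) (w b))).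
    rewrite !bil_cadd, !bil_place by (apply Nx || apply Nw; lia).
    rewrite bil_ctr.
    apply f_equal2; apply f_equal2; apply bil_ext; try easy; intros; (apply Hx || apply Hw); lia. }
  rewrite Nat.add_1_r.
  rewrite (sumR_ext (S r) _ (fun a =>
    (sumR (S r) (fun b => bil n n (reM (QXX n r m s P Sm A0 Cp G a b)) (x a) (x b))
     + sumR (S r) (fun b => bil n (d b) (reM (QXW n m s P Bq Cp Dpq G H th a b)) (x a) (w b)))
    + (sumR (S r) (fun b => bil n (d a) (reM (QXW n m s P Bq Cp Dpq G H th b a)) (x b) (w a))
     + sumR (S r) (fun b => bil (d a) (d b) (reM (QWW m s Dpq H th a b)) (w a) (w b)))))
    by (intros; now rewrite !sumR_plus).
  rewrite !sumR_plus.
  (* Exchanging the summations turns the lower off-diagonal blocks into a second copy of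
     [form_XW]. *)
  rewrite (sumR_swap (S r) (S r) (fun a b => bil n (d a) _ (x b) (w a))).
  rewrite form_XX, form_XW, form_WW. unfold LK.
  rewrite (sumR_ext (S r) (fun i => bil n n P (x O) (mv n (Ai m s A0 Bq Cp Dpq i th) (x i))) (fun i =>
    bil n n P (x O) (mv n (A0 i) (x i))
    + bil n (d i) (rmul (d i) (rmul n P (Bq i)) (Defs.Delta m s i th)) (x O) (w i)))
    by (intros; apply bil_Ai).
  rewrite sumR_plus. ring.
Qed.

(** The test vector stacks the states and then the [w i]. One nonzero state entry makes it nonzero,
    whatever the [w i] are. *)
Lemma LK_neg :
  neg_def (Qsize n r m s) (Qmat n r m s P Sm A0 Bq Cp Dpq G H th) ->
  (exists a i, (a <= r)%nat /\ (i < n)%nat /\ x a i <> 0) ->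
  LK n r P Sm (fun i => Ai m s A0 Bq Cp Dpq i th) x < 0.
Proof.
  intros [_ neg] (a & i & Ha & Hi & xai).
  destruct (stack_blocks (S r) (fun _ => n) x) as [zx Hzx].
  destruct (stack_blocks (S r) d w) as [zw Hzw].
  pose (z := fun k => if Nat.ltb k (n * (r + 1)) then zx k else zw (k - n * (r + 1))%nat).
  assert (Hx : forall a i, (a <= r)%nat -> (i < n)%nat -> z (xoff n a + i)%nat = x a i).
  { intros b j Hb Hj. unfold z, xoff.
    destruct (Nat.ltb_spec (b * n + j) (n * (r + 1))); [|nia].
    rewrite <- Hzx, sumN_const by lia. easy. }
  rewrite <- (form_LK z Hx).
  - rewrite <- quadratic_form_real. apply neg. exists (xoff n a + i)%nat. split.
    + unfold Qsize, xoff. nia.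
    + intros E. apply xai. rewrite <- Hx by easy. now injection E.
  - intros b j Hb Hj. unfold z, woff.
    destruct (Nat.ltb_spec (n * (r + 1) + sumN b (dim m s) + j) (n * (r + 1))); [lia|].
    rewrite <- Hzw by lia. f_equal. unfold d. lia.
Qed.

End ReducedForm.

(** * Uniformity over the polytope *)

Lemma cv_const c : Un_cv (fun _ => c) c.
Proof. intros e He. exists O. intros. now rewrite Rdist_eq. Qed.

Lemma cv_sumR N u l : (forall i, (i < N)%nat -> Un_cv (fun k => u k i) (l i)) ->
  Un_cv (fun k => sumR N (u k)) (sumR N l).
Proof.
  induction N as [|N IH]; simpl; intros H; [apply cv_const|].
  apply (CV_plus (fun k => sumR N (u k)) (fun k => u k N)); [apply IH; intros|]; apply H; lia.
Qed.

Lemma cv_inv u l : l <> 0 -> Un_cv u l -> Un_cv (fun k => / u k) (/ l).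
Proof.
  intros Hl Hu. apply (continuity_seq (fun x => / x)); [|easy].
  apply (continuity_pt_inv id); [apply derivable_continuous, derivable_id|easy].
Qed.

(** The condition [k <= phi k] stands in for strict monotonicity: it suffices for limits to be
    inherited and is preserved by composition. *)
Lemma cv_subseq u l phi : (forall k, (k <= phi k)%nat) -> Un_cv u l -> Un_cv (fun k => u (phi k)) l.
Proof.
  intros Hphi Hu e He. destruct (Hu e He) as [K HK]. exists K. intros k Hk.
  apply HK. specialize (Hphi k). lia.
Qed.

Lemma bounded_subseq1 (u : nat -> R) B : (forall k, Rabs (u k) <= B) ->
  exists phi l, (forall k, (k <= phi k)%nat) /\ Un_cv (fun k => u (phi k)) l.
Proof.
  intros HB.
  destruct (Bolzano_Weierstrass u (fun c => - B <= c <= B)) as [l Hl].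
  - apply compact_P3.
  - intros k. specialize (HB k). revert HB. unfold Rabs. destruct Rcase_abs; lra.
  - assert (H : forall k, exists p, (k <= p)%nat /\ Rabs (u p - l) < RinvN k).
    { intros k. destruct (Hl (disc l (RinvN k)) k) as [p [Hp Hd]].
      - exists (RinvN k). now intros y.
      - now exists p. }
    destruct (functional_choice _ H) as [phi Hphi].
    exists phi, l. split; [apply Hphi|].
    intros e He. destruct (RinvN_cv He) as [K HK]. exists K. intros k Hk.
    specialize (HK k Hk). unfold Rdist in *. rewrite Rminus_0_r in HK.
    destruct (Hphi k) as [_ Hk']. pose proof (Rle_abs (RinvN k)). lra.
Qed.

Lemma bounded_subseq N (u : nat -> nat -> R) B :
  (forall k i, (i < N)%nat -> Rabs (u k i) <= B) ->
  exists phi l, (forall k, (k <= phi k)%nat) /\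
    forall i, (i < N)%nat -> Un_cv (fun k => u (phi k) i) (l i).
Proof.
  induction N as [|N IH]; intros HB.
  - exists (fun k => k), (fun _ => 0). split; intros; lia.
  - destruct IH as (phi & l & Hphi & Hl); [intros; apply HB; lia|].
    destruct (bounded_subseq1 (fun k => u (phi k) N) B) as (psi & c & Hpsi & Hc);
      [intros; apply HB; lia|].
    exists (fun k => phi (psi k)), (fun i => if Nat.eqb i N then c else l i). split.
    + intros k. specialize (Hphi (psi k)). specialize (Hpsi k). lia.
    + intros i Hi. destruct (Nat.eqb_spec i N) as [->|]; [easy|].
      apply (cv_subseq (fun k => u (phi k) i)); [easy|]. apply Hl. lia.
Qed.

(** Barycentric coordinates parametrise the polytope. They lie in [[0, 1]] and their constraints
    pass to limits, so the polytope itself never has to be shown compact. *)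
Definition simplex nv (lam : nat -> R) : Prop :=
  (forall j, (j < nv)%nat -> 0 <= lam j) /\ sumR nv lam = 1.

Definition sqn N (z : nat -> R) : R := sumR N (fun i => z i ^ 2).

Lemma sqn_nonneg N z : 0 <= sqn N z.
Proof. apply sumR_nonneg; intros. apply pow2_ge_0. Qed.

Lemma sqn_term N z i : (i < N)%nat -> z i ^ 2 <= sqn N z.
Proof. apply (sumR_term_le N (fun i => z i ^ 2)). intros. apply pow2_ge_0. Qed.

Lemma sqn_scal N c z : sqn N (fun i => c * z i) = c ^ 2 * sqn N z.
Proof. unfold sqn. rewrite <- sumR_scal. apply sumR_ext; intros; ring. Qed.

Lemma sqn_0 N z : sqn N z = 0 -> forall i, (i < N)%nat -> z i = 0.
Proof. intros E i Hi. pose proof (sqn_term N z i Hi). nra. Qed.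

Lemma sqn_neq0 N z : sqn N z <> 0 -> exists i, (i < N)%nat /\ z i <> 0.
Proof.
  intros H. destruct (classic (exists i, (i < N)%nat /\ z i <> 0)) as [|E]; [easy|].
  destruct H. apply sumR_0. intros i Hi.
  destruct (Req_dec (z i) 0) as [->|]; [ring|]. destruct E. now exists i.
Qed.

(** If every [eps = 1/(k+1)] fails, rescaling the counterexamples gives unit vectors with
    [f <= 1/(k+1)]. The limit along a subsequence is a unit vector with [f <= 0], against
    positivity. *)
Lemma quadratic_coercive nv N (f : (nat -> R) -> (nat -> R) -> R) :
  (forall lk lam zk z, simplex nv lam ->
     (forall j, (j < nv)%nat -> Un_cv (fun k => lk k j) (lam j)) ->
     (forall i, (i < N)%nat -> Un_cv (fun k => zk k i) (z i)) ->
     Un_cv (fun k => f (lk k) (zk k)) (f lam z)) ->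
  (forall lam z c, f lam (fun i => c * z i) = c ^ 2 * f lam z) ->
  (forall lam z, simplex nv lam -> (exists i, (i < N)%nat /\ z i <> 0) -> 0 < f lam z) ->
  exists eps, 0 < eps /\ forall lam z, simplex nv lam -> eps * sqn N z <= f lam z.
Proof.
  intros cont hom pos.
  (* Such a [z] cannot be rescaled, and its entries from [N] on are arbitrary. The constant sequence
     [0 * z] converges to [z] in the coordinates that count, so continuity and homogeneity give
     0. *)
  assert (zero : forall lam z, simplex nv lam -> sqn N z = 0 -> f lam z = 0).
  { intros lam z Hlam Hz.
    apply (UL_sequence (fun _ => f lam (fun i => 0 * z i))).
    - apply (cont (fun _ => lam) lam (fun _ i => 0 * z i) z Hlam).
      + intros; apply cv_const.
      + intros i Hi. rewrite (sqn_0 N z Hz i Hi), Rmult_0_l. apply cv_const.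
    - rewrite hom. replace (0 ^ 2 * f lam z) with 0 by ring. apply cv_const. }
  apply NNPP. intros contra.
  assert (H : forall k, exists p : (nat -> R) * (nat -> R),
    simplex nv (fst p) /\ sqn N (snd p) = 1 /\ f (fst p) (snd p) <= RinvN k).
  { intros k. apply NNPP. intros no. apply contra. exists (RinvN k).
    split; [apply cond_pos|]. intros lam z Hlam.
    destruct (Req_dec (sqn N z) 0) as [E|E].
    - rewrite E, (zero lam z) by easy. lra.
    - apply Rnot_lt_le. intros lt. apply no.
      pose proof (sqn_nonneg N z). set (q := sqn N z) in *.
      assert (0 < q) by lra.
      assert (Hs : (/ sqrt q) ^ 2 = / q).
      { rewrite <- Rinv_pow, pow2_sqrt; [easy|lra|]. apply Rgt_not_eq, sqrt_lt_R0. lra. }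
      exists (lam, fun i => / sqrt q * z i). simpl fst; simpl snd.
      split; [easy|]. rewrite sqn_scal, hom, Hs. fold q. split; [now field|].
      apply Rmult_le_reg_l with q; [easy|]. rewrite <- Rmult_assoc, Rinv_r by lra. lra. }
  destruct (functional_choice _ H) as [p Hp].
  destruct (bounded_subseq nv (fun k => fst (p k)) 1) as (phi & lam & Hphi & Hlam).
  { intros k j Hj. destruct (Hp k) as [[nn one] _].
    rewrite Rabs_pos_eq by now apply nn. rewrite <- one. now apply sumR_term_le. }
  destruct (bounded_subseq N (fun k => snd (p (phi k))) 1) as (psi & z & Hpsi & Hz).
  { intros k j Hj. destruct (Hp (phi k)) as [_ [one _]].
    pose proof (sqn_term N (snd (p (phi k))) j Hj) as t. rewrite one in t.
    apply Rabs_le. nra. }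
  assert (Hlam' : forall j, (j < nv)%nat -> Un_cv (fun k => fst (p (phi (psi k))) j) (lam j)).
  { intros j Hj. apply (cv_subseq (fun k => fst (p (phi k)) j)); auto. }
  assert (Hs : simplex nv lam).
  { split.
    - intros j Hj. apply Rle_cv_lim with (fun _ => 0) (fun k => fst (p (phi (psi k))) j).
      + intros k. now apply (Hp (phi (psi k))).
      + apply cv_const.
      + now apply Hlam'.
    - apply (UL_sequence (fun k => sumR nv (fst (p (phi (psi k)))))); [now apply cv_sumR|].
      intros e He. exists O. intros k _. destruct (Hp (phi (psi k))) as [[_ ->] _].
      now rewrite Rdist_eq. }
  assert (Hq : sqn N z = 1).
  { apply (UL_sequence (fun k => sqn N (snd (p (phi (psi k)))))).
    - apply (cv_sumR N (fun k i => snd (p (phi (psi k))) i ^ 2)). intros i Hi. simpl.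
      apply CV_mult; [now apply Hz|]. apply CV_mult; [now apply Hz|apply cv_const].
    - intros e He. exists O. intros k _. destruct (Hp (phi (psi k))) as [_ [-> _]].
      now rewrite Rdist_eq. }
  assert (0 < f lam z).
  { apply pos; [easy|]. apply sqn_neq0. lra. }
  enough (f lam z <= 0) by lra.
  apply Rle_cv_lim with (fun k => f (fst (p (phi (psi k)))) (snd (p (phi (psi k)))))
    (fun k => RinvN (phi (psi k)) : R).
  - intros k. apply Hp.
  - now apply cont.
  - apply (cv_subseq (fun k => RinvN k : R)); [|apply RinvN_cv].
    intros k. specialize (Hphi (psi k)). specialize (Hpsi k). lia.
Qed.

(** * Continuity of the system matrices in the parameter *)

Lemma cv_mv k (Mk : nat -> RMat) M vk v i :
  (forall l, Un_cv (fun j => Mk j i l) (M i l)) ->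
  (forall l, (l < k)%nat -> Un_cv (fun j => vk j l) (v l)) ->
  Un_cv (fun j => mv k (Mk j) (vk j) i) (mv k M v i).
Proof.
  intros HM Hv. apply (cv_sumR k (fun j l => Mk j i l * vk j l)). intros l Hl.
  apply CV_mult; auto.
Qed.

Lemma cv_bil p q M uk u vk v :
  (forall l, (l < p)%nat -> Un_cv (fun j => uk j l) (u l)) ->
  (forall l, (l < q)%nat -> Un_cv (fun j => vk j l) (v l)) ->
  Un_cv (fun j => bil p q M (uk j) (vk j)) (bil p q M u v).
Proof.
  intros Hu Hv. apply (cv_sumR p (fun j a => sumR q (fun b => uk j a * M a b * vk j b))).
  intros a Ha. apply (cv_sumR q (fun j b => uk j a * M a b * vk j b)). intros b Hb.
  apply CV_mult; [apply CV_mult|]; auto using cv_const.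
Qed.

Lemma cv_rmul k (Ak Bk : nat -> RMat) A B i j :
  (forall a b, Un_cv (fun l => Ak l a b) (A a b)) ->
  (forall a b, Un_cv (fun l => Bk l a b) (B a b)) ->
  Un_cv (fun l => rmul k (Ak l) (Bk l) i j) (rmul k A B i j).
Proof.
  intros HA HB. apply (cv_sumR k (fun l a => Ak l i a * Bk l a j)). intros.
  now apply CV_mult.
Qed.

Lemma cv_det k (Ak : nat -> RMat) A :
  (forall a b, Un_cv (fun l => Ak l a b) (A a b)) ->
  Un_cv (fun l => det k (Ak l)) (det k A).
Proof.
  revert Ak A. induction k as [|k IH]; intros Ak A HA; [exact (cv_const 1)|].
  apply (cv_sumR (S k) (fun l j => (-1) ^ j * Ak l O j * det k (minor O j (Ak l)))).
  intros j _. apply CV_mult; [apply CV_mult; [apply cv_const|apply HA]|].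
  apply IH. intros; apply HA.
Qed.

Lemma cv_rinv k (Ak : nat -> RMat) A i j : det k A <> 0 ->
  (forall a b, Un_cv (fun l => Ak l a b) (A a b)) ->
  Un_cv (fun l => rinv k (Ak l) i j) (rinv k A i j).
Proof.
  intros Hd HA. apply CV_mult; [apply CV_mult; [apply cv_const|]|].
  - apply cv_det. intros; apply HA.
  - now apply cv_inv; [|apply cv_det].
Qed.

Lemma cv_Delta m s i (thk : nat -> nat -> R) th p q :
  (forall k, (k < m)%nat -> Un_cv (fun l => thk l k) (th k)) ->
  Un_cv (fun l => Defs.Delta m s i (thk l) p q) (Defs.Delta m s i th p q).
Proof.
  intros H. unfold Defs.Delta. destruct (Nat.eqb p q); [|apply cv_const].
  apply (cv_sumR m (fun l k => if andb (Nat.leb (soff s i k) p) (Nat.ltb p (soff s i k + s k i))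
    then thk l k else 0)).
  intros k Hk. destruct (andb _ _); [auto|apply cv_const].
Qed.

Lemma cv_Ai m s A0 Bq Cp Dpq i (thk : nat -> nat -> R) th p q :
  det (dim m s i) (rsub idm (DD m s Dpq i th)) <> 0 ->
  (forall k, (k < m)%nat -> Un_cv (fun l => thk l k) (th k)) ->
  Un_cv (fun l => Ai m s A0 Bq Cp Dpq i (thk l) p q) (Ai m s A0 Bq Cp Dpq i th p q).
Proof.
  intros Hd Hth.
  pose proof (cv_Delta m s i thk th) as HD.
  apply CV_plus; [apply cv_const|].
  apply cv_rmul; [|intros; apply cv_const]. intros.
  apply cv_rmul; intros.
  - apply cv_rmul; intros; [apply cv_const|now apply HD].
  - apply cv_rinv; [easy|]. intros. apply CV_minus; [apply cv_const|].
    apply cv_rmul; intros; [apply cv_const|now apply HD].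
Qed.

(** Membership in the polytope fixes only the coordinates below [m], so [theta] and its barycentric
    combination may differ elsewhere as functions. *)
Lemma Ai_ext m s A0 Bq Cp Dpq i th th' : (forall k, (k < m)%nat -> th k = th' k) ->
  Ai m s A0 Bq Cp Dpq i th = Ai m s A0 Bq Cp Dpq i th'.
Proof.
  intros E.
  assert (ED : Defs.Delta m s i th = Defs.Delta m s i th').
  { apply functional_extensionality; intros p. apply functional_extensionality; intros q.
    unfold Defs.Delta. destruct (Nat.eqb p q); [|easy].
    apply sumR_ext; intros k Hk. now rewrite E. }
  unfold Ai, DD. now rewrite ED.
Qed.

(** The simplex with one vertex serves as a dummy parameter space for [quadratic_coercive]. *)
Lemma spd_coercive n P : spd n P ->
  exists c, 0 < c /\ forall v, c * sqn n v <= bil n n P v v.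
Proof.
  intros [_ pos].
  destruct (quadratic_coercive 1 n (fun _ v => bil n n P v v)) as (c & Hc & H).
  - intros. now apply cv_bil.
  - intros _ v c. unfold bil. rewrite <- sumR_scal. apply sumR_ext; intros.
    rewrite <- sumR_scal. apply sumR_ext; intros. ring.
  - intros _ v _ Hv. now apply pos.
  - exists c. split; [easy|]. intros v. apply (H (fun _ => 1)).
    split; intros; simpl; lra.
Qed.

(** The multipliers are chosen separately at each [theta] and supply only pointwise negativity.
    Compactness then bounds the form by the norm of all [r + 1] stacked states, of which the
    undelayed block is kept. *)
Lemma LK_coercive n m r nv V s A0 Bq Cp Dpq P Sm :
  (forall th, in_polytope m nv V th -> forall i, (i <= r)%nat ->
     det (dim m s i) (rsub idm (DD m s Dpq i th)) <> 0) ->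
  spd n P ->
  (forall th, in_polytope m nv V th ->
     exists G H : nat -> CMat,
       neg_def (Qsize n r m s) (Qmat n r m s P Sm A0 Bq Cp Dpq G H th)) ->
  exists eps, 0 < eps /\ forall th x, in_polytope m nv V th ->
    LK n r P Sm (fun i => Ai m s A0 Bq Cp Dpq i th) x <= - eps * sqn n (x O).
Proof.
  intros wellposed [Psym _] lmi.
  pose (th := fun lam k => sumR nv (fun j => lam j * V j k)).
  assert (poly : forall lam, simplex nv lam -> in_polytope m nv V (th lam)).
  { intros lam [H1 H2]. now exists lam. }
  destruct (quadratic_coercive nv (S r * n) (fun lam z =>
    - LK n r P Sm (fun i => Ai m s A0 Bq Cp Dpq i (th lam)) (fun a i => z (a * n + i)%nat)))
    as (eps & Heps & H).
  - intros lk lam zk z Hs Hlk Hzk. apply CV_opp.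
    assert (Hx : forall a i, (a <= r)%nat -> (i < n)%nat ->
      Un_cv (fun k => zk k (a * n + i)%nat) (z (a * n + i)%nat)).
    { intros. apply Hzk. nia. }
    unfold LK.
    apply CV_minus; [apply CV_plus; [apply CV_mult; [apply cv_const|]|]|].
    + apply (cv_sumR (S r) (fun k i => bil n n P (fun i => zk k (0 * n + i)%nat)
        (mv n (Ai m s A0 Bq Cp Dpq i (th (lk k))) (fun j => zk k (i * n + j)%nat)))).
      intros i Hi. apply cv_bil; [intros; apply Hx; lia|]. intros l Hl.
      apply (cv_mv n (fun k => Ai m s A0 Bq Cp Dpq i (th (lk k))) _
        (fun k j => zk k (i * n + j)%nat)); [|intros; apply Hx; lia].
      intros b. apply (cv_Ai m s A0 Bq Cp Dpq i (fun k => th (lk k))).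
      * apply wellposed; [now apply poly|lia].
      * intros k Hk. apply (cv_sumR nv (fun l j => lk l j * V j k)). intros.
        apply CV_mult; auto using cv_const.
    + apply (cv_sumR r (fun k l => bil n n (Sm (S l)) (fun i => zk k (0 * n + i)%nat)
        (fun i => zk k (0 * n + i)%nat))).
      intros. apply (cv_bil _ _ _ (fun k i => zk k (0 * n + i)%nat) _ (fun k i => zk k (0 * n + i)%nat));
        intros; apply Hx; lia.
    + apply (cv_sumR r (fun k l => bil n n (Sm (S l)) (fun i => zk k (S l * n + i)%nat)
        (fun i => zk k (S l * n + i)%nat))).
      intros a Ha. apply (cv_bil _ _ _ (fun k i => zk k (S a * n + i)%nat) _ (fun k i => zk k (S a * n + i)%nat));
        intros; apply Hx; lia.
  - intros lam z c. unfold LK.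
    assert (E : forall M a b, bil n n M (fun i => c * z (a * n + i)%nat) (fun i => c * z (b * n + i)%nat)
      = c ^ 2 * bil n n M (fun i => z (a * n + i)%nat) (fun i => z (b * n + i)%nat)).
    { intros. unfold bil. rewrite <- sumR_scal. apply sumR_ext; intros.
      rewrite <- sumR_scal. apply sumR_ext; intros. ring. }
    rewrite (sumR_ext (S r) _ (fun i => c ^ 2 * bil n n P (fun j => z (0 * n + j)%nat)
      (mv n (Ai m s A0 Bq Cp Dpq i (th lam)) (fun j => z (i * n + j)%nat))))
      by (intros; now rewrite <- !bil_rmul, E).
    rewrite !sumR_scal.
    rewrite (sumR_ext r _ (fun l => c ^ 2 * bil n n (Sm (S l)) (fun j => z (0 * n + j)%nat)
      (fun j => z (0 * n + j)%nat))) by (intros; apply E).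
    rewrite (sumR_ext r (fun l => bil n n (Sm (S l)) (fun i => c * z (S l * n + i)%nat) _)
      (fun l => c ^ 2 * bil n n (Sm (S l)) (fun j => z (S l * n + j)%nat)
      (fun j => z (S l * n + j)%nat))) by (intros; apply E).
    rewrite !sumR_scal. ring.
  - intros lam z Hs (k & Hk & Hz).
    destruct (lmi _ (poly _ Hs)) as (G & H & neg).
    apply Ropp_0_gt_lt_contravar.
    apply (LK_neg n r m s A0 Bq Cp Dpq P Sm G H); [easy|now apply wellposed, poly|easy|].
    assert (n <> O) by (intros ->; lia).
    exists (k / n)%nat, (k mod n)%nat. repeat split.
    + apply Nat.lt_succ_r, Nat.Div0.div_lt_upper_bound; lia.
    + now apply Nat.mod_upper_bound.
    + now rewrite Nat.mul_comm, <- Nat.div_mod.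
  - exists eps. split; [easy|]. intros th0 x (lam & H1 & H2 & H3).
    destruct (stack_blocks (S r) (fun _ => n) x) as [z Hz].
    assert (Hz' : forall a j, (a <= r)%nat -> (j < n)%nat -> z (a * n + j)%nat = x a j).
    { intros a j Ha Hj. rewrite <- sumN_const. apply Hz; lia. }
    specialize (H lam z (conj H1 H2)).
    assert (Hsq : sqn n (x O) <= sqn (S r * n) z).
    { unfold sqn. simpl Nat.mul. rewrite sumR_app.
      rewrite (sumR_ext n (fun i => x O i ^ 2) (fun i => z i ^ 2)).
      - pose proof (sumR_nonneg (r * n) (fun i => z (n + i)%nat ^ 2) ltac:(intros; apply pow2_ge_0)).
        lra.
      - intros. now rewrite <- (Hz' O i) by lia. }
    enough (E : LK n r P Sm (fun i => Ai m s A0 Bq Cp Dpq i th0) x =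
      LK n r P Sm (fun i => Ai m s A0 Bq Cp Dpq i (th lam)) (fun a i => z (a * n + i)%nat)) by nra.
    unfold LK.
    rewrite (sumR_ext (S r) (fun i => bil n n P (x O) _) (fun i =>
      bil n n P (fun i => z (0 * n + i)%nat) (mv n (Ai m s A0 Bq Cp Dpq i (th lam)) (fun j => z (i * n + j)%nat)))).
    2:{ intros i Hi. rewrite (Ai_ext _ _ _ _ _ _ _ th0 (th lam) H3), <- !bil_rmul.
        symmetry. apply bil_ext; try easy; intros; apply Hz'; lia. }
    f_equal; [f_equal|]; apply sumR_ext; intros; symmetry;
      apply bil_ext; try easy; intros; apply Hz'; lia.
Qed.

(** * Absolutely continuous functions *)

Section Primitive.
Import Coquelicot.

(** The primitive lives on the whole line because the delay terms evaluate it at [t - h_i], possibly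
    negative. *)
Lemma continuous_primitive (f : R -> R) : continuity f ->
  exists F, forall t, derivable_pt_lim F t (f t).
Proof.
  intros Hf. exists (RInt f 0). intros t. apply is_derive_Reals.
  assert (Hc : forall z, continuous f z) by (intros; apply continuity_pt_filterlim, Hf).
  apply (is_derive_RInt f (RInt f 0) 0 t); [|apply Hc].
  apply filter_forall. intros z. apply (@RInt_correct R_CompleteNormedModule).
  apply (@ex_RInt_continuous R_CompleteNormedModule). intros; apply Hc.
Qed.

End Primitive.

Lemma continuity_bounded f a b : continuity f ->
  exists M, 0 < M /\ forall t, a <= t <= b -> Rabs (f t) <= M.
Proof.
  intros Hf. destruct (Rle_dec a b) as [ab|].
  - destruct (continuity_ab_maj (fun t => Rabs (f t)) a b ab) as [c [Hc _]].
    { intros t _. apply (continuity_pt_comp f Rabs); [apply Hf|apply Rcontinuity_abs]. }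
    exists (Rabs (f c) + 1). pose proof (Rabs_pos (f c)). split; [lra|].
    intros t Ht. specialize (Hc t Ht). simpl in Hc. lra.
  - exists 1. split; intros; lra.
Qed.

Lemma ac_dist a b f : abs_cont_on a b f -> forall eps, 0 < eps ->
  exists delta, 0 < delta /\ forall u v, a <= u <= b -> a <= v <= b ->
    Rabs (u - v) < delta -> Rabs (f u - f v) < eps.
Proof.
  intros Hf eps He. destruct (Hf eps He) as (delta & Hd & H).
  exists delta. split; [easy|].
  assert (H1 : forall u v, a <= u -> u <= v -> v <= b -> v - u < delta -> Rabs (f v - f u) < eps).
  { intros u v Hu Huv Hv Hl.
    specialize (H 1%nat (fun _ => u) (fun _ => v)). simpl in H.
    enough (0 + Rabs (f v - f u) < eps) by lra.
    apply H; intros; lra || lia. }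
  intros u v Hu Hv Huv. destruct (Rle_dec u v).
  - rewrite Rabs_minus_sym. rewrite Rabs_minus_sym, Rabs_pos_eq in Huv by lra. apply H1; lra.
  - rewrite Rabs_pos_eq in Huv by lra. apply H1; lra.
Qed.

Lemma ac_sub a b a' b' f : a <= a' -> b' <= b -> abs_cont_on a b f -> abs_cont_on a' b' f.
Proof.
  intros Ha Hb Hf eps He. destruct (Hf eps He) as (delta & Hd & H).
  exists delta. split; [easy|]. intros N u v Huv. apply H.
  intros j Hj. specialize (Huv j Hj). lra.
Qed.

Lemma ac_ext a b f g : (forall t, a <= t <= b -> f t = g t) ->
  abs_cont_on a b f -> abs_cont_on a b g.
Proof.
  intros E Hf eps He. destruct (Hf eps He) as (delta & Hd & H).
  exists delta. split; [easy|]. intros N u v Huv Hord Hs.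
  rewrite (sumR_ext N _ (fun j => Rabs (f (v j) - f (u j)))).
  - now apply H.
  - intros j Hj. specialize (Huv j Hj). rewrite !E; lra.
Qed.

(** Sums and products both reduce to this increment bound; after the factor [M], the tolerances
    [eps / (2 * M)] for [f] and [g] add up to [eps]. *)
Lemma ac_dominated a b f g F M : 0 < M -> abs_cont_on a b f -> abs_cont_on a b g ->
  (forall u v, a <= u -> u <= v -> v <= b ->
     Rabs (F v - F u) <= M * (Rabs (f v - f u) + Rabs (g v - g u))) ->
  abs_cont_on a b F.
Proof.
  intros HM Hf Hg HF eps He.
  destruct (Hf (eps / (2 * M))) as (d1 & Hd1 & H1); [apply Rdiv_lt_0_compat; lra|].
  destruct (Hg (eps / (2 * M))) as (d2 & Hd2 & H2); [apply Rdiv_lt_0_compat; lra|].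
  exists (Rmin d1 d2). split; [now apply Rmin_pos|]. intros N u v Huv Hord Hs.
  pose proof (Rmin_l d1 d2). pose proof (Rmin_r d1 d2).
  specialize (H1 N u v Huv Hord ltac:(lra)). specialize (H2 N u v Huv Hord ltac:(lra)).
  apply Rle_lt_trans with (M * (sumR N (fun j => Rabs (f (v j) - f (u j)))
    + sumR N (fun j => Rabs (g (v j) - g (u j))))).
  - rewrite <- sumR_plus, <- sumR_scal. apply sumR_le. intros j Hj.
    destruct (Huv j Hj) as (? & ? & ?). now apply HF.
  - replace eps with (M * (eps / (2 * M) + eps / (2 * M))) by (field; lra).
    apply Rmult_lt_compat_l; lra.
Qed.

Lemma ac_plus a b f g : abs_cont_on a b f -> abs_cont_on a b g ->
  abs_cont_on a b (fun t => f t + g t).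
Proof.
  intros Hf Hg. apply (ac_dominated a b f g _ 1); try easy; [lra|]. intros u v _ _ _.
  replace (f v + g v - (f u + g u)) with (f v - f u + (g v - g u)) by ring.
  pose proof (Rabs_triang (f v - f u) (g v - g u)). lra.
Qed.

Lemma ac_mult a b f g : continuity f -> continuity g ->
  abs_cont_on a b f -> abs_cont_on a b g -> abs_cont_on a b (fun t => f t * g t).
Proof.
  intros Cf Cg Hf Hg.
  destruct (continuity_bounded f a b Cf) as (M1 & HM1 & H1).
  destruct (continuity_bounded g a b Cg) as (M2 & HM2 & H2).
  apply (ac_dominated a b f g _ (M1 + M2)); try easy; [lra|]. intros u v Hu Huv Hv.
  replace (f v * g v - f u * g u) with ((f v - f u) * g v + f u * (g v - g u)) by ring.
  eapply Rle_trans; [apply Rabs_triang|]. rewrite !Rabs_mult.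
  specialize (H1 u ltac:(lra)). specialize (H2 v ltac:(lra)).
  pose proof (Rabs_pos (f v - f u)). pose proof (Rabs_pos (g v - g u)).
  pose proof (Rabs_pos (f u)). pose proof (Rabs_pos (g v)). nra.
Qed.

Lemma ac_lipschitz a b f M : 0 < M ->
  (forall u v, a <= u -> u <= v -> v <= b -> Rabs (f v - f u) <= M * (v - u)) ->
  abs_cont_on a b f.
Proof.
  intros HM Hf eps He. exists (eps / M). split; [now apply Rdiv_lt_0_compat|].
  intros N u v Huv _ Hs.
  apply Rle_lt_trans with (M * sumR N (fun j => v j - u j)).
  - rewrite <- sumR_scal. apply sumR_le. intros j Hj. destruct (Huv j Hj) as (? & ? & ?).
    now apply Hf.
  - replace eps with (M * (eps / M)) by (field; lra). now apply Rmult_lt_compat_l.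
Qed.

Lemma ac_const a b c : abs_cont_on a b (fun _ => c).
Proof.
  apply (ac_lipschitz a b _ 1); [lra|]. intros. rewrite Rminus_diag, Rabs_R0. lra.
Qed.

Lemma ac_sumR a b N f : (forall i, (i < N)%nat -> abs_cont_on a b (f i)) ->
  abs_cont_on a b (fun t => sumR N (fun i => f i t)).
Proof.
  induction N as [|N IH]; intros H; simpl; [apply ac_const|].
  apply ac_plus; [apply IH; intros|]; apply H; lia.
Qed.

Lemma ac_C1 a b F f : (forall t, derivable_pt_lim F t (f t)) -> continuity f ->
  abs_cont_on a b F.
Proof.
  intros HF Cf. destruct (continuity_bounded f a b Cf) as (M & HM & H).
  apply (ac_lipschitz a b F M HM). intros u v Hu Huv Hv.
  destruct (Req_dec u v) as [->|]; [rewrite !Rminus_diag, Rabs_R0; lra|].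
  destruct (MVT_cor2 F f u v) as (c & -> & Hc); [lra|now intros|].
  rewrite Rabs_mult, (Rabs_pos_eq (v - u)) by lra.
  apply Rmult_le_compat_r; [lra|]. apply H. lra.
Qed.

(** * Almost everywhere nonpositive derivative *)

(** For [a <= b] and [u <= v], [clip a b v - clip a b u] is the length of the overlap of [[u, v]]
    and [[a, b]]. Written as a difference, it is additive in [[u, v]] by telescoping. *)
Definition clip (a b t : R) : R := Rmin (Rmax t a) b.

(* The total length of the parts of [u, v] inside [al k, be k] for [k < K]; overlaps count twice. *)
Definition covered (al be : nat -> R) K u v : R :=
  sumR K (fun k => clip (al k) (be k) v - clip (al k) (be k) u).

Ltac minmax :=
  unfold clip, Rmax;
  repeat match goal with |- context [Rle_dec ?x ?y] => destruct (Rle_dec x y) end;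
  unfold Rmin;
  repeat match goal with |- context [Rle_dec ?x ?y] => destruct (Rle_dec x y) end; lra.

Section Covered.

Variables al be : nat -> R.
Hypothesis albe : forall k, al k <= be k.

Lemma covered_chasles K u v w : covered al be K u v + covered al be K v w = covered al be K u w.
Proof. unfold covered. rewrite <- sumR_plus. apply sumR_ext. intros; ring. Qed.

Lemma covered_mono K K' u v : u <= v -> (K <= K')%nat ->
  covered al be K u v <= covered al be K' u v.
Proof.
  intros uv HK. replace K' with (K + (K' - K))%nat by lia. unfold covered. rewrite sumR_app.
  enough (0 <= sumR (K' - K) (fun i => clip (al (K + i)%nat) (be (K + i)%nat) v
    - clip (al (K + i)%nat) (be (K + i)%nat) u)) by lra.
  apply sumR_nonneg. intros i _. minmax.
Qed.

Lemma covered_inside K k u v : (k < K)%nat -> al k < u -> u <= v -> v < be k ->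
  v - u <= covered al be K u v.
Proof.
  intros Hk Hu Huv Hv.
  apply Rle_trans with (clip (al k) (be k) v - clip (al k) (be k) u); [minmax|].
  apply (sumR_term_le K (fun k => clip (al k) (be k) v - clip (al k) (be k) u)); [|easy].
  intros. minmax.
Qed.

Lemma covered_le K u v : u <= v -> covered al be K u v <= sumR K (fun k => be k - al k).
Proof. intros. apply sumR_le. intros k _. specialize (albe k). minmax. Qed.

End Covered.

(** The derivative controls only quotients based at [c], so [[u, v]] is split at [c] and the two
    one-sided estimates are added. *)
Lemma straddle f c l eps : l <= 0 -> derivable_pt_lim f c l -> 0 < eps ->
  exists eta, 0 < eta /\ forall u v, c - eta < u -> u <= c -> c <= v -> v < c + eta ->
    f v - f u <= eps * (v - u).
Proof.
  intros Hl Hf He. destruct (Hf eps He) as [eta H].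
  exists eta. split; [apply cond_pos|]. intros u v Hu Huc Hcv Hv.
  assert (H1 : f v - f c <= eps * (v - c)).
  { destruct (Req_dec v c) as [->|]; [lra|].
    specialize (H (v - c) ltac:(lra)). rewrite Rabs_pos_eq in H by lra.
    specialize (H ltac:(lra)). replace (c + (v - c)) with v in H by ring.
    apply Rabs_def2 in H.
    replace (f v - f c) with ((f v - f c) / (v - c) * (v - c)) by (field; lra).
    apply Rmult_le_compat_r; lra. }
  assert (H2 : f c - f u <= eps * (c - u)).
  { destruct (Req_dec u c) as [->|]; [lra|].
    specialize (H (u - c) ltac:(lra)). rewrite Rabs_left in H by lra.
    specialize (H ltac:(lra)). replace (c + (u - c)) with u in H by ring.
    apply Rabs_def2 in H.
    replace (f c - f u) with ((f u - f c) / (u - c) * (c - u)) by (field; lra).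
    apply Rmult_le_compat_r; lra. }
  lra.
Qed.

(* Continuous induction on [t]: the part of [a, t] treated so far splits into intervals near
   points of differentiability, where [f] grows by at most [eps] times the length, and disjoint
   intervals lying in the cover of the null set, whose total length the clip functions control. *)
Lemma ac_nonincreasing a b f (E : R -> Prop) : a <= b -> abs_cont_on a b f -> null_set E ->
  (forall t, a <= t <= b -> E t \/ exists l, l <= 0 /\ derivable_pt_lim f t l) -> f b <= f a.
Proof.
  intros ab Hf HE Hd. apply Rnot_lt_le. intros lt.
  (* The growth will be at most [eps * (b - a)] near points of differentiability plus [eps] on the
     cover, which is only half of [f b - f a]. *)
  set (eps := (f b - f a) / (2 * (1 + (b - a)))).
  assert (He : 0 < eps) by (apply Rdiv_lt_0_compat; lra).
  assert (Heq : eps * (1 + (b - a)) = (f b - f a) / 2) by (unfold eps; field; lra).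
  destruct (Hf eps He) as (delta & Hdel & Hac).
  (* Half of [delta], since absolute continuity asks for total length strictly below [delta]. *)
  destruct (HE (delta / 2)) as (al & be & albe & cov & len); [lra|].
  pose (Good := fun t => a <= t <= b /\ exists N u v K,
    (forall j, (j < N)%nat -> a <= u j /\ u j <= v j /\ v j <= t) /\
    (forall j, (S j < N)%nat -> v j <= u (S j)) /\
    sumR N (fun j => v j - u j) <= covered al be K a t /\
    f t - f a <= eps * (t - a) + sumR N (fun j => Rabs (f (v j) - f (u j)))).
  assert (Ga : Good a).
  { split; [lra|]. exists O, (fun _ => 0), (fun _ => 0), O. unfold covered; simpl.
    repeat split; intros; lia || lra. }
  destruct (completeness Good) as [c [Hub Hlub]].
  { exists b. intros t Ht. apply Ht. }
  { now exists a. }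
  assert (Hc : a <= c <= b).
  { split; [now apply Hub|]. apply Hlub. intros t Ht. apply Ht. }
  (* Goodness passes across the supremum [c], from any good [s] shortly before it to any [t] shortly
     after it, in both cases for [c]. *)
  assert (ext : exists eta, 0 < eta /\ forall s t, Good s -> c - eta < s -> s <= c -> c <= t ->
    t < c + eta -> t <= b -> Good t).
  { destruct (Hd c Hc) as [Ec|(l & Hl & Hder)].
    - destruct (cov c Ec) as (k & Hk1 & Hk2).
      exists (Rmin (c - al k) (be k - c)). split; [apply Rmin_pos; lra|].
      intros s t (Has & N & u & v & K & V1 & V2 & V3 & V4) Hs Hsc Hct Ht Htb.
      pose proof (Rmin_l (c - al k) (be k - c)). pose proof (Rmin_r (c - al k) (be k - c)).
      split; [lra|].
      (* [[s, t]] is appended with index [N]; enlarging [K] to at least [S k] makes the covered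
         length pay for it. *)
      exists (S N), (fun j => if Nat.eqb j N then s else u j),
        (fun j => if Nat.eqb j N then t else v j), (Nat.max K (S k)).
      assert (EN : forall (A : Type) (p q : nat -> A), forall j, (j < N)%nat ->
        (if Nat.eqb j N then p j else q j) = q j).
      { intros A p q j Hj. destruct (Nat.eqb_spec j N); [lia|easy]. }
      repeat split.
      + destruct (Nat.eqb_spec j N); [lra|]. now apply V1; lia.
      + destruct (Nat.eqb_spec j N); [lra|]. now apply V1; lia.
      + destruct (Nat.eqb_spec j N); [lra|].
        destruct (V1 j ltac:(lia)) as (_ & _ & ?). lra.
      + intros j Hj. destruct (Nat.eqb_spec j N); [lia|].
        destruct (Nat.eqb_spec (S j) N); [|apply V2; lia].
        now apply V1; lia.
      + simpl. rewrite Nat.eqb_refl.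
        rewrite (sumR_ext N _ (fun j => v j - u j))
          by (intros j Hj; destruct (Nat.eqb_spec j N); [lia|easy]).
        rewrite <- (covered_chasles al be _ a s t).
        pose proof (covered_mono al be K (Nat.max K (S k)) a s ltac:(lra) ltac:(lia)).
        pose proof (covered_inside al be (Nat.max K (S k)) k s t ltac:(lia) ltac:(lra) ltac:(lra)
          ltac:(lra)).
        lra.
      + simpl. rewrite Nat.eqb_refl.
        rewrite (sumR_ext N _ (fun j => Rabs (f (v j) - f (u j))))
          by (intros j Hj; destruct (Nat.eqb_spec j N); [lia|easy]).
        pose proof (Rle_abs (f t - f s)).
        assert (0 <= eps * (t - s)) by (apply Rmult_le_pos; lra). lra.
    - destruct (straddle f c l eps Hl Hder He) as (eta & Heta & H).
      exists eta. split; [easy|].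
      intros s t (Has & N & u & v & K & V1 & V2 & V3 & V4) Hs Hsc Hct Ht Htb.
      split; [lra|]. exists N, u, v, K. repeat split; try now apply V1.
      + destruct (V1 j ltac:(easy)) as (_ & _ & ?). lra.
      + easy.
      + rewrite <- (covered_chasles al be _ a s t).
        (* With [O] intervals on the left, monotonicity says that the covered length of [[s, t]] is
           nonnegative. *)
        pose proof (covered_mono al be O K s t ltac:(lra) ltac:(lia)) as H0.
        unfold covered at 1 in H0. simpl in H0. lra.
      + specialize (H s t Hs Hsc Hct Ht). lra. }
  destruct ext as (eta & Heta & ext).
  assert (exists s, Good s /\ c - eta < s) as (s & Gs & Hs).
  { apply NNPP. intros no. enough (c <= c - eta) by lra.
    apply Hlub. intros s Gs. apply Rnot_lt_le. intros ls. apply no. now exists s. }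
  assert (Hsc : s <= c) by now apply Hub.
  assert (Gb : Good b).
  (* Either a good point beyond [c] contradicts the supremum, or [b] is within reach of [c]. *)
  { destruct (Rlt_le_dec (c + eta / 2) b) as [l|l].
    - assert (G : Good (c + eta / 2)) by (apply (ext s); lra || easy).
      apply Hub in G. lra.
    - apply (ext s); lra || easy. }
  destruct Gb as (_ & N & u & v & K & V1 & V2 & V3 & V4).
  specialize (Hac N u v V1 V2).
  pose proof (covered_le al be albe K a b ab). specialize (len K).
  specialize (Hac ltac:(lra)). lra.
Qed.

(** * Stability of trajectories *)

Lemma continuity_sumR N (f : nat -> R -> R) : (forall i, (i < N)%nat -> continuity (f i)) ->
  continuity (fun t => sumR N (fun i => f i t)).
Proof.
  induction N as [|N IH]; intros H; simpl.
  - apply continuity_const. now intros t t'.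
  - apply (continuity_plus (fun t => sumR N (fun i => f i t)) (f N));
      [apply IH; intros|]; apply H; lia.
Qed.

Lemma derivable_pt_lim_sumR N (f : nat -> R -> R) l t :
  (forall i, (i < N)%nat -> derivable_pt_lim (f i) t (l i)) ->
  derivable_pt_lim (fun t => sumR N (fun i => f i t)) t (sumR N l).
Proof.
  induction N as [|N IH]; intros H; simpl.
  - apply derivable_pt_lim_const.
  - apply (derivable_pt_lim_plus (fun t => sumR N (fun i => f i t)) (f N));
      [apply IH; intros|]; apply H; lia.
Qed.

Lemma derivable_pt_lim_local f g t l a b : a < t < b ->
  (forall u, a < u < b -> f u = g u) -> derivable_pt_lim f t l -> derivable_pt_lim g t l.
Proof.
  intros Ht E Hf e He. destruct (Hf e He) as [d Hd].
  assert (Hm : 0 < Rmin d (Rmin (t - a) (b - t))).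
  { repeat apply Rmin_pos; try apply cond_pos; lra. }
  exists (mkposreal _ Hm). simpl. intros h h0 Hh.
  pose proof (Rmin_l d (Rmin (t - a) (b - t))). pose proof (Rmin_r d (Rmin (t - a) (b - t))).
  pose proof (Rmin_l (t - a) (b - t)). pose proof (Rmin_r (t - a) (b - t)).
  assert (- Rabs h <= h <= Rabs h) by (split; [pose proof (Rle_abs (- h)); rewrite Rabs_Ropp in *|pose proof (Rle_abs h)]; lra).
  rewrite <- !E by lra. apply Hd; [easy|lra].
Qed.

Lemma bil_upper n M : exists kap, 0 < kap /\ forall v, bil n n M v v <= kap * sqn n v.
Proof.
  exists (1 + sumR n (fun i => sumR n (fun j => Rabs (M i j)))). split.
  - enough (0 <= sumR n (fun i => sumR n (fun j => Rabs (M i j)))) by lra.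
    apply sumR_nonneg; intros. apply sumR_nonneg; intros. apply Rabs_pos.
  - intros v. pose proof (sqn_nonneg n v).
    enough (bil n n M v v <= sqn n v * sumR n (fun i => sumR n (fun j => Rabs (M i j)))) by nra.
    rewrite <- sumR_scal. apply sumR_le; intros i Hi.
    rewrite <- sumR_scal. apply sumR_le; intros j Hj.
    pose proof (sqn_term n v i Hi). pose proof (sqn_term n v j Hj).
    assert (Hv : Rabs (v i * v j) <= sqn n v) by (apply Rabs_le; nra).
    replace (v i * M i j * v j) with (v i * v j * M i j) by ring.
    eapply Rle_trans; [apply Rle_abs|]. rewrite Rabs_mult.
    apply Rmult_le_compat_r; [apply Rabs_pos|easy].
Qed.

Lemma deriv_nonneg_increasing F f : (forall t, derivable_pt_lim F t (f t)) ->
  (forall t, 0 <= f t) -> forall a b, a <= b -> F a <= F b.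
Proof.
  intros HF Hf a b ab. destruct (Req_dec a b) as [->|]; [lra|].
  destruct (MVT_cor2 F f a b) as (c & Hc & _); [lra|now intros|].
  specialize (Hf c). nra.
Qed.

(* Barbalat's lemma with a one-sided Lipschitz bound: if [p] is large at [t], it stays large on
   a whole interval to the left of [t], which costs a fixed amount of the bounded [E]. *)
Lemma barbalat p E g K kap B : 0 < K -> 0 < kap ->
  (forall t, derivable_pt_lim E t (g t)) -> (forall t, 0 <= g t) ->
  (forall t, p t <= kap * g t) ->
  (forall a b, 0 < a -> a <= b -> p b <= p a + K * (b - a)) ->
  (forall t, 1 <= t -> E t <= B) ->
  forall eta, 0 < eta -> exists T, forall t, T <= t -> p t < eta.
Proof.
  intros HK Hkap HE Hg Hp HL HB eta Heta.
  (* Within time [tau] the function [p] can rise by at most [eta / 2], so [p t >= eta] forces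
     [p >= eta / 2] on [[t - tau, t]]. Then [E] grows there by at least [gain]. *)
  set (tau := eta / (2 * K)).
  set (gain := eta / (2 * kap) * tau).
  assert (Htau : 0 < tau) by (apply Rdiv_lt_0_compat; lra).
  assert (Hgain : 0 < gain).
  { apply Rmult_lt_0_compat; [apply Rdiv_lt_0_compat; lra|easy]. }
  (* Past some [t1] the increasing function [E] is within [gain] of its supremum and cannot grow by
     [gain] again. *)
  destruct (completeness (fun e => exists t, 1 <= t /\ e = E t)) as [L [HL1 HL2]].
  { exists B. intros e (t & Ht & ->). now apply HB. }
  { exists (E 1), 1. split; lra. }
  assert (exists t1, 1 <= t1 /\ L - gain < E t1) as (t1 & Ht1 & HEt1).
  { apply NNPP. intros no. enough (L <= L - gain) by lra.
    apply HL2. intros e (t & Ht & ->). apply Rnot_lt_le. intros l. apply no. now exists t. }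
  exists (t1 + tau). intros t Ht. apply Rnot_le_lt. intros Hpt.
  (* One mean value point [c] suffices, as the lower bound on [g] holds throughout the interval. *)
  destruct (MVT_cor2 E g (t - tau) t) as (c & Hc & Hct); [lra|now intros|].
  specialize (HL c t ltac:(lra) ltac:(lra)).
  pose proof (deriv_nonneg_increasing E g HE Hg t1 (t - tau) ltac:(lra)).
  assert (E t <= L) by (apply HL1; exists t; split; [lra|easy]).
  assert (Hg1 : eta / (2 * kap) <= g c).
  { apply Rmult_le_reg_l with kap; [easy|].
    replace (kap * (eta / (2 * kap))) with (eta / 2) by (field; lra).
    assert (K * tau = eta / 2) by (unfold tau; field; lra).
    specialize (Hp c). nra. }
  assert (gain <= g c * tau) by (apply Rmult_le_compat_r; lra).
  replace (t - (t - tau)) with tau in Hc by ring. lra.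
Qed.

(** * The Lyapunov-Krasovskii functional along one trajectory *)

Section Trajectory.

Variables (n : nat) (y : R -> nat -> R).
Hypothesis y_cont : forall k, (k < n)%nat -> continuity (fun t => y t k).

Lemma continuity_bil M : continuity (fun t => bil n n M (y t) (y t)).
Proof.
  apply (continuity_sumR n (fun i t => sumR n (fun j => y t i * M i j * y t j))). intros i Hi.
  apply (continuity_sumR n (fun j t => y t i * M i j * y t j)). intros j Hj.
  apply (continuity_mult (fun t => y t i * M i j) (fun t => y t j)); [|auto].
  apply (continuity_mult (fun t => y t i) (fun _ => M i j)); [auto|].
  apply continuity_const. now intros t t'.
Qed.

Lemma continuity_sqn : continuity (fun t => sqn n (y t)).
Proof.
  apply (continuity_sumR n (fun i t => y t i ^ 2)). intros i Hi.
  apply (continuity_mult (fun t => y t i) (fun t => y t i * 1)); [auto|].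
  apply (continuity_mult (fun t => y t i) (fun _ => 1)); [auto|].
  apply continuity_const. now intros t t'.
Qed.

Lemma ac_bil a b M : (forall k, (k < n)%nat -> abs_cont_on a b (fun t => y t k)) ->
  abs_cont_on a b (fun t => bil n n M (y t) (y t)).
Proof.
  intros Hy.
  apply (ac_sumR a b n (fun i t => sumR n (fun j => y t i * M i j * y t j))). intros i Hi.
  apply (ac_sumR a b n (fun j t => y t i * M i j * y t j)). intros j Hj.
  assert (Cm : continuity (fun _ : R => M i j)) by (apply continuity_const; now intros t t').
  apply (ac_mult a b (fun t => y t i * M i j) (fun t => y t j)); auto.
  - apply (continuity_mult (fun t => y t i) (fun _ => M i j)); auto.
  - apply (ac_mult a b (fun t => y t i) (fun _ => M i j)); auto using ac_const.
Qed.

Lemma derivable_bil M t g :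
  (forall k, (k < n)%nat -> derivable_pt_lim (fun u => y u k) t (g k)) ->
  derivable_pt_lim (fun u => bil n n M (y u) (y u)) t
    (bil n n M g (y t) + bil n n M (y t) g).
Proof.
  intros Hg. unfold bil at 2 3. rewrite <- sumR_plus.
  apply (derivable_pt_lim_sumR n (fun i t => sumR n (fun j => y t i * M i j * y t j))). intros i Hi.
  rewrite <- sumR_plus.
  apply (derivable_pt_lim_sumR n (fun j t => y t i * M i j * y t j)). intros j Hj.
  apply (derivable_pt_lim_mult (fun t => y t i * M i j) (fun t => y t j)); [|auto].
  replace (g i * M i j) with (g i * M i j + y t i * 0) by ring.
  apply (derivable_pt_lim_mult (fun t => y t i) (fun _ => M i j)); [auto|].
  apply derivable_pt_lim_const.
Qed.

Variables (r : nat) (h : nat -> R) (P : RMat) (Sm : nat -> RMat) (A : R -> nat -> RMat).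
Variables (E : R -> Prop) (eps : R).

Hypothesis h0 : h O = 0.
Hypothesis h_nonneg : forall i, (1 <= i <= r)%nat -> 0 <= h i.
Hypothesis P_spd : spd n P.
Hypothesis S_spd : forall i, (1 <= i <= r)%nat -> spd n (Sm i).
Hypothesis y_ac : forall a b k, 0 <= a -> (k < n)%nat -> abs_cont_on a b (fun t => y t k).
Hypothesis E_null : null_set E.
Hypothesis y_eq : forall t, 0 < t -> E t \/ forall k, (k < n)%nat ->
  derivable_pt_lim (fun u => y u k) t
    (sumR (S r) (fun i => mv n (A t i) (y (t - h i)) k)).
Hypothesis eps_pos : 0 < eps.
Hypothesis A_LK : forall t x, 0 <= t -> LK n r P Sm (A t) x <= - eps * sqn n (x O).

Let p t := bil n n P (y t) (y t).
Let q i t := bil n n (Sm i) (y t) (y t).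

Lemma spd_nonneg M v : spd n M -> 0 <= bil n n M v v.
Proof.
  intros HM. destruct (spd_coercive n M HM) as (c & Hc & H).
  pose proof (sqn_nonneg n v). specialize (H v). nra.
Qed.

(** By symmetry of [P] the derivative is [2 y^T P y'], which is [LK] with its [Sm] terms undone. *)
Lemma p_deriv t : 0 < t -> E t \/ derivable_pt_lim p t
  (LK n r P Sm (A t) (fun i => y (t - h i))
   - sumR r (fun i => q (S i) t) + sumR r (fun i => q (S i) (t - h (S i)))).
Proof.
  intros Ht. destruct (y_eq t Ht) as [|Hd]; [now left|right].
  unfold LK. rewrite h0, Rminus_0_r. fold (q (S O) t).
  match goal with |- derivable_pt_lim _ _ ?l =>
    replace l with (bil n n P (fun k => sumR (S r) (fun i => mv n (A t i) (y (t - h i)) k)) (y t)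
      + bil n n P (y t) (fun k => sumR (S r) (fun i => mv n (A t i) (y (t - h i)) k))) end.
  - now apply derivable_bil.
  - rewrite (bil_sym n P (proj1 P_spd) _ (y t)), (bil_vsum n n P (y t) (S r)
      (fun i => mv n (A t i) (y (t - h i)))).
    unfold q. ring.
Qed.

Let F_spec : forall i, exists F, forall t, derivable_pt_lim F t (q i t) :=
  fun i => continuous_primitive (q i) (continuity_bil (Sm i)).

Lemma derivable_shift F f c : (forall t, derivable_pt_lim F t (f t)) ->
  forall t, derivable_pt_lim (fun t => F (t - c)) t (f (t - c)).
Proof.
  intros HF t. rewrite <- (Rmult_1_r (f (t - c))).
  apply (derivable_pt_lim_comp (fun t => t - c) F); [|apply HF].
  replace 1 with (1 - 0) by ring.
  apply (derivable_pt_lim_minus id (fun _ => c)); [apply derivable_pt_lim_id|].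
  apply derivable_pt_lim_const.
Qed.

Lemma continuity_shift f c : continuity f -> continuity (fun t => f (t - c)).
Proof.
  intros Hf. apply (continuity_comp (fun t => t - c) f); [|easy].
  apply (continuity_minus id (fun _ => c)); [apply derivable_continuous, derivable_id|].
  apply continuity_const. now intros t t'.
Qed.

(* The primitives [F i] of [q i] express the delay terms [\int_(t - h_i)^t q_i] of the
   Lyapunov-Krasovskii functional. *)
Lemma lyapunov_nonincreasing (F : nat -> R -> R) J :
  (forall i t, derivable_pt_lim (F i) t (q i t)) ->
  (forall t, derivable_pt_lim J t (sqn n (y t))) ->
  let W t := p t + (sumR r (fun i => F (S i) t - F (S i) (t - h (S i))) + eps * J t) in
  forall a b, 0 < a -> a <= b -> W b <= W a.
Proof.
  intros HF HJ W a b Ha ab.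
  assert (HD : forall i t, derivable_pt_lim (fun t => F i t - F i (t - h i)) t (q i t - q i (t - h i))).
  { intros i t. apply (derivable_pt_lim_minus (F i) (fun t => F i (t - h i))); [apply HF|].
    apply (derivable_shift _ _ _ (HF i)). }
  assert (HeJ : forall t, derivable_pt_lim (fun t => eps * J t) t (eps * sqn n (y t))).
  { intros t. now apply (derivable_pt_lim_scal J). }
  apply (ac_nonincreasing a b W E ab); [|easy|].
  - apply ac_plus; [apply ac_bil; intros; apply y_ac; easy || lra|]. apply ac_plus.
    + apply (ac_sumR a b r (fun i t => F (S i) t - F (S i) (t - h (S i)))). intros i _.
      apply (ac_C1 a b _ _ (HD (S i))).
      apply (continuity_minus (q (S i)) (fun t => q (S i) (t - h (S i))));
        [|apply continuity_shift]; apply continuity_bil.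
    + apply (ac_C1 a b _ _ HeJ).
      apply (continuity_scal (fun t => sqn n (y t))), continuity_sqn.
  - intros t Ht. destruct (p_deriv t) as [|Hp]; [lra|now left|right].
    (* The derivative is assembled first, which instantiates the existential; its sign comes
       second. *)
    eexists. split; cycle 1.
    + apply (derivable_pt_lim_plus p (fun t => sumR r (fun i => F (S i) t - F (S i) (t - h (S i)))
        + eps * J t)); [exact Hp|].
      apply (derivable_pt_lim_plus (fun t => sumR r (fun i => F (S i) t - F (S i) (t - h (S i))))
        (fun t => eps * J t)); [|apply HeJ].
      apply (derivable_pt_lim_sumR r (fun i t => F (S i) t - F (S i) (t - h (S i)))
        (fun i => q (S i) t - q (S i) (t - h (S i)))). intros; apply HD.
    (* The [q] terms of [p_deriv] cancel those of the delay integrals, leaving [LK] plus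
       [eps * sqn n (y t)]. *)
    + rewrite sumR_minus.
      specialize (A_LK t (fun i => y (t - h i)) ltac:(lra)).
      cbv beta in A_LK. rewrite h0, Rminus_0_r in A_LK. lra.
Qed.

Lemma trajectory_stable :
  (exists M, forall t, 0 <= t -> sqn n (y t) <= M) /\
  (forall eta, 0 < eta -> exists T, forall t, T <= t -> sqn n (y t) < eta).
Proof.
  destruct (functional_choice _ F_spec) as [F HF].
  destruct (continuous_primitive _ continuity_sqn) as [J HJ].
  pose proof (lyapunov_nonincreasing F J HF HJ) as HW. cbv zeta in HW.
  destruct (spd_coercive n P P_spd) as (c & Hc & Hlow).
  destruct (bil_upper n P) as (kap & Hkap & Hup).
  set (D := fun t => sumR r (fun i => F (S i) t - F (S i) (t - h (S i)))) in HW.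
  assert (D_nonneg : forall t, 0 <= D t).
  { intros t. apply sumR_nonneg. intros i Hi.
    assert (Hq : forall u, 0 <= q (S i) u) by (intros; apply spd_nonneg, S_spd; lia).
    specialize (h_nonneg (S i) ltac:(lia)).
    pose proof (deriv_nonneg_increasing (F (S i)) (q (S i)) (HF (S i)) Hq
      (t - h (S i)) t ltac:(lra)). lra. }
  assert (J_incr : forall a b, a <= b -> J a <= J b).
  { apply (deriv_nonneg_increasing J (fun t => sqn n (y t)) HJ). intros; apply sqn_nonneg. }
  assert (p_nonneg : forall t, 0 <= p t) by (intros; now apply spd_nonneg).
  (* Time 1 stands for any positive time: the functional is known to decrease only on [t > 0]. *)
  set (W1 := p 1 + D 1).
  assert (HW1 : forall t, 1 <= t -> p t + eps * (J t - J 1) <= W1).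
  { intros t Ht. specialize (HW 1 t ltac:(lra) Ht). cbv beta in HW. fold (D t) (D 1) in HW.
    specialize (D_nonneg t). unfold W1. lra. }
  (* The start [a] is arbitrary because delayed states need a bound from [- h i] on; up to time 1
     continuity provides it. *)
  assert (bounded_from : forall a, exists M, 0 < M /\ forall t, a <= t -> sqn n (y t) <= M).
  { intros a. destruct (continuity_bounded _ a 1 continuity_sqn) as (M & HM & H).
    exists (M + W1 / c).
    assert (0 <= W1) by (specialize (p_nonneg 1); specialize (D_nonneg 1); unfold W1; lra).
    assert (0 <= W1 / c) by (apply Rmult_le_pos; [easy|]; left; now apply Rinv_0_lt_compat).
    split; [lra|]. intros t Ht. destruct (Rle_dec t 1) as [t1|t1].
    - specialize (H t ltac:(lra)). cbv beta in H. pose proof (Rle_abs (sqn n (y t))). lra.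
    - enough (sqn n (y t) <= W1 / c) by lra.
      apply Rmult_le_reg_l with c; [easy|]. replace (c * (W1 / c)) with W1 by (field; lra).
      specialize (HW1 t ltac:(lra)). specialize (J_incr 1 t ltac:(lra)).
      specialize (Hlow (y t)). fold (p t) in Hlow. nra. }
  split.
  { destruct (bounded_from 0) as (M & _ & H). exists M. exact H. }
  assert (delay_bound : exists K, 0 < K /\ forall t, 0 <= t ->
    sumR r (fun i => q (S i) (t - h (S i))) <= K).
  { assert (Hi : forall i, exists K, (i < r)%nat -> 0 < K /\
      forall t, 0 <= t -> q (S i) (t - h (S i)) <= K).
    { intros i. destruct (bounded_from (- h (S i))) as (M & HM & H).
      destruct (bil_upper n (Sm (S i))) as (k & Hk & Hu). exists (k * M). intros _.
      split; [now apply Rmult_lt_0_compat|]. intros t Ht.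
      eapply Rle_trans; [apply Hu|]. apply Rmult_le_compat_l; [lra|]. apply H. lra. }
    destruct (functional_choice _ Hi) as [K HK].
    exists (sumR r K + 1). split.
    - enough (0 <= sumR r K) by lra. apply sumR_nonneg. intros i Hir.
      destruct (HK i Hir). lra.
    - intros t Ht. enough (sumR r (fun i => q (S i) (t - h (S i))) <= sumR r K) by lra.
      apply sumR_le. intros i Hir. now apply HK. }
  destruct delay_bound as (K & HK & HKb).
  assert (p_lip : forall a b, 0 < a -> a <= b -> p b <= p a + K * (b - a)).
  { intros a b Ha ab.
    enough (p b + - K * b <= p a + - K * a) by lra.
    apply (ac_nonincreasing a b (fun t => p t + - K * t) E ab); [|easy|].
    - apply ac_plus; [apply ac_bil; intros; apply y_ac; easy || lra|].
      apply (ac_C1 a b _ (fun _ => - K)); [|apply continuity_const; now intros t t'].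
      intros t. rewrite <- (Rmult_1_r (- K)) at 2.
      apply (derivable_pt_lim_scal id), derivable_pt_lim_id.
    - intros t Ht. destruct (p_deriv t) as [|Hp]; [lra|now left|right].
      eexists. split; cycle 1.
      + apply (derivable_pt_lim_plus p (fun t => - K * t)); [exact Hp|].
        apply (derivable_pt_lim_scal id), derivable_pt_lim_id.
      + specialize (A_LK t (fun i => y (t - h i)) ltac:(lra)). specialize (HKb t ltac:(lra)).
        cbv beta in A_LK. pose proof (sqn_nonneg n (y (t - h O))).
        assert (0 <= sumR r (fun i => q (S i) t)).
        { apply sumR_nonneg. intros i Hi. apply spd_nonneg, S_spd. lia. }
        nra. }
  assert (J_bound : forall t, 1 <= t -> J t <= J 1 + W1 / eps).
  { intros t Ht. specialize (HW1 t Ht). specialize (p_nonneg t).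
    apply Rmult_le_reg_l with eps; [easy|].
    replace (eps * (J 1 + W1 / eps)) with (eps * J 1 + W1) by (field; lra). lra. }
  intros eta Heta.
  (* The threshold is [c * eta] because [c * sqn n (y t) <= p t]. *)
  destruct (barbalat p J (fun t => sqn n (y t)) K kap (J 1 + W1 / eps) HK Hkap HJ
    (fun t => sqn_nonneg n (y t)) (fun t => Hup (y t)) p_lip J_bound (c * eta)) as [T HT].
  { now apply Rmult_lt_0_compat. }
  exists T. intros t Ht. apply Rmult_lt_reg_l with c; [easy|].
  specialize (HT t Ht). specialize (Hlow (y t)). fold (p t) in Hlow. lra.
Qed.

End Trajectory.

(** * Extension of solutions to the whole line, and conclusion *)

Lemma hmax_ge r h i : (i <= r)%nat -> h i <= hmax r h.
Proof.
  induction r as [|r IH]; intros Hi; simpl.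
  - replace i with O by lia. lra.
  - pose proof (Rmax_l (hmax r h) (h (S r))). pose proof (Rmax_r (hmax r h) (h (S r))).
    destruct (Nat.eq_dec i (S r)) as [->|]; [easy|]. specialize (IH ltac:(lia)). lra.
Qed.

Lemma ac_clamp_continuous f a : (forall T, 0 < T -> abs_cont_on a T f) ->
  continuity (fun t => f (Rmax t a)).
Proof.
  intros Hf t e He.
  pose proof (Rmax_l t a). pose proof (Rmax_r t a). pose proof (Rmax_l (Rmax t a) 0).
  pose proof (Rmax_r (Rmax t a) 0).
  (* One unit of room, so that clamped points within distance 1 of [t] stay in [[a, T]], and [T] is
     positive. *)
  set (T := Rmax (Rmax t a) 0 + 1).
  destruct (ac_dist a T f (Hf T ltac:(unfold T; lra)) e He) as (d & Hd & H3).
  exists (Rmin d 1). split; [now apply Rmin_pos; lra|].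
  intros u [_ Hu]. simpl in *. unfold Rdist in *.
  pose proof (Rmin_l d 1). pose proof (Rmin_r d 1).
  assert (Hc : Rabs (Rmax u a - Rmax t a) <= Rabs (u - t)).
  { unfold Rmax, Rabs. repeat destruct Rle_dec; repeat destruct Rcase_abs; lra. }
  pose proof (Rle_abs (Rmax u a - Rmax t a)). pose proof (Rmax_r u a).
  unfold T in H3. apply H3; lra.
Qed.

Theorem theorem1
  (n m r nv : nat) (V : nat -> nat -> R) (s : nat -> nat -> nat)
  (A0 Bq Cp Dpq : nat -> RMat) (P : RMat) (Sm : nat -> RMat) :
  (1 <= n)%nat -> (1 <= m)%nat -> (1 <= r)%nat ->
  in_polytope m nv V (fun _ => 0) ->
  (forall th, in_polytope m nv V th -> forall i, (i <= r)%nat ->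
     det (dim m s i) (rsub idm (DD m s Dpq i th)) <> 0) ->
  spd n P ->
  (forall i, (1 <= i <= r)%nat -> spd n (Sm i)) ->
  (forall th, in_polytope m nv V th ->
     exists G H : nat -> CMat,
       neg_def (Qsize n r m s) (Qmat n r m s P Sm A0 Bq Cp Dpq G H th)) ->
  GAS_indep_delays n r m (in_polytope m nv V) s A0 Bq Cp Dpq.
Proof.
  intros _ _ _ _ wellposed P_spd S_spd lmi h h0 h_nonneg th Hth x [x_ac x_eq].
  destruct (LK_coercive n m r nv V s A0 Bq Cp Dpq P Sm wellposed P_spd lmi) as (eps & Heps & HLK).
  set (a := - hmax r h) in x_ac.
  assert (Ha : a <= 0) by (pose proof (hmax_ge r h O (Nat.le_0_l r)); unfold a; lra).
  (* The solution is frozen before [-h]. For [t > 0] every delayed time [t - h i] lies beyond [-h],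
     so [y] satisfies the same equation. *)
  set (y := fun t k => x (Rmax t a) k).
  assert (xy : forall t, a <= t -> y t = x t).
  { intros t Ht. unfold y. now rewrite Rmax_left. }
  destruct (trajectory_stable n y) with (r := r) (h := h) (P := P) (Sm := Sm)
    (A := fun t i => Ai m s A0 Bq Cp Dpq i (th t))
    (E := fun t => 0 < t /\ ~ (forall k, (k < n)%nat ->
          derivable_pt_lim (fun u => x u k) t (rhs n r m s A0 Bq Cp Dpq h th x t k)))
    (eps := eps) as [[M HM] H0]; try easy.
  - intros k Hk. apply (ac_clamp_continuous (fun t => x t k)). intros. now apply x_ac.
  - intros b c k Hb Hk. apply (ac_ext b c (fun t => x t k)).
    + intros t Ht. now rewrite xy by lra.
    + pose proof (Rmax_l c 1). pose proof (Rmax_r c 1).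
      apply (ac_sub a (Rmax c 1)); [lra|lra|]. apply x_ac; [lra|easy].
  - intros t Ht.
    destruct (classic (forall k, (k < n)%nat ->
      derivable_pt_lim (fun u => x u k) t (rhs n r m s A0 Bq Cp Dpq h th x t k))) as [Hd|];
      [right|now left].
    intros k Hk.
    apply (derivable_pt_lim_local (fun u => x u k) _ _ _ 0 (t + 1)); [lra| |].
    + intros u Hu. now rewrite xy by lra.
    + replace (sumR _ _) with (rhs n r m s A0 Bq Cp Dpq h th x t k); [now apply Hd|].
      unfold rhs. rewrite Nat.add_1_r. apply sumR_ext. intros i Hi. unfold mv.
      rewrite xy; [easy|]. pose proof (hmax_ge r h i ltac:(lia)). unfold a. lra.
  - intros t z Ht. now apply HLK, Hth.
  - split.
    + exists (sqrt M). intros t Ht. rewrite <- xy by lra. apply sqrt_le_1_alt. now apply HM.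
    + intros e He. destruct (H0 (e ^ 2)) as [T HT]; [now apply pow_lt|].
      (* [T] may be negative, while [x] and [y] are known to agree only from [a] on. *)
      exists (Rmax T 0). intros t Ht. pose proof (Rmax_l T 0). pose proof (Rmax_r T 0).
      rewrite <- xy by lra. rewrite <- (sqrt_pow2 e) by lra.
      apply sqrt_lt_1_alt. split; [apply sqn_nonneg|]. apply HT. lra.
Qed.
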